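(* Let $H$ be a fixed graph and let $a,b$ be positive integers. Then the threshold probability for Enforcer's win in the monotone $(a:b)$ Avoider-Enforcer vertex $H$-game played on $G\sim G(n,p)$ is $n^{-1/m(H)}$: if $p=\omega(n^{-1/m(H)})$ then w.h.p. Enforcer wins, and if $p=o(n^{-1/m(H)})$ then w.h.p. Avoider wins. Furthermore, if $H$ is strictly balanced, then there exists a constant $N=N(a,b,v(H))$ such that for the random graph process $\tilde G$, w.h.p. $\tau(\tilde G,\mathcal E)=\tau(\tilde G,\mathcal G_{NH})$, where $\mathcal E$ is the property of being Enforcer's win in the monotone $(a:b)$ Avoider-Enforcer vertex $H$-game.
   Context: For a graph $F$, $d(F)=e(F)/v(F)$, $m(F)=\max\{d(F'):F'\subseteq F\}$; $F$ is strictly balanced if $d(F)>d(F')$ for every proper subgraph $F'\subsetneq F$. The monotone $(a:b)$ Avoider-Enforcer vertex $H$-game on a graph $G$: Avoider and Enforcer alternately claim previously unclaimed vertices of $G$, Avoider claiming at least $a$ and Enforcer at least $b$ vertices per turn (the last player may claim fewer if not enough remain), until all are claimed; Avoider loses if the subgraph of $G$ induced by his vertices contains a (not necessarily induced) copy of $H$, and wins otherwise. $G(n,p)$ is the binomial random graph. The random graph process $\tilde G=(G_i)_{i=0}^{\binom n2}$ on $[n]$ adds the edges of $K_n$ one by one in uniformly random order; $\tau(\tilde G,\mathcal P)=\min\{i:G_i\in\mathcal P\}$. $\mathcal G_{NH}$ is the property of containing $N$ (possibly intersecting) copies of $H$. ''W.h.p.'' means with probability tending to 1 as $n\to\infty$.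 The statement holds with either player moving first. *)

(* Defs.v *)
From Stdlib Require Import Reals.
From mathcomp Require Import all_boot.

Set Implicit Arguments.
Unset Strict Implicit.
Unset Printing Implicit Defensive.

(* R_scope is opened; nat comparisons are marked %N. Note that with
   MathComp loaded, the key %R denotes ring_scope, not R_scope. *)
Local Open Scope R_scope.

(* A finite simple graph on vertex set 'I_k is a set of 2-element subsets. *)
Definition graph_wf (k : nat) (E : {set {set 'I_k}}) : Prop :=
  forall e, e \in E -> (#|e| = 2)%N.

Definition Kedges (n : nat) : {set {set 'I_n}} := [set e : {set 'I_n} | #|e| == 2%N].

Definition is_subgraph (k : nat) (EH : {set {set 'I_k}})
    (SF : {set 'I_k} * {set {set 'I_k}}) : bool :=
  [&& SF.1 != set0, SF.2 \subset EH & [forall e in SF.2, e \subset SF.1]].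

Definition density (k : nat) (SF : {set 'I_k} * {set {set 'I_k}}) : R :=
  (INR #|SF.2| / INR #|SF.1|).

Definition mH (k : nat) (EH : {set {set 'I_k}}) : R :=
  foldr Rmax 0
    [seq density SF | SF <- enum [set SF | is_subgraph EH SF]].

Definition strictly_balanced (k : nat) (EH : {set {set 'I_k}}) : Prop :=
  forall SF : {set 'I_k} * {set {set 'I_k}},
    is_subgraph EH SF -> SF != (setT, EH) ->
    (density SF < density ((setT : {set 'I_k}), EH)).

Definition contains_copy (k : nat) (EH : {set {set 'I_k}}) (n : nat)
    (E : {set {set 'I_n}}) (A : {set 'I_n}) : bool :=
  [exists f : {ffun 'I_k -> 'I_n},
    [&& injectiveb f, [forall x, f x \in A] & [forall e in EH, (f @: e) \in E]]].

Definition num_copies (k : nat) (EH : {set {set 'I_k}}) (n : nat)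
    (E : {set {set 'I_n}}) : nat :=
  #|[set SF : {set 'I_n} * {set {set 'I_n}} |
     [exists f : {ffun 'I_k -> 'I_n},
       [&& injectiveb f, SF.1 == f @: setT,
           SF.2 == (fun e : {set 'I_k} => f @: e) @: EH & SF.2 \subset E]]]|.

Definition has_N_copies (k : nat) (EH : {set {set 'I_k}}) (N : nat) (n : nat)
    (E : {set {set 'I_n}}) : bool :=
  (N <= num_copies EH E)%N.

Definition legal_move (n c : nat) (U M : {set 'I_n}) : bool :=
  (M \subset U) && (minn c #|U| <= #|M|)%N.

(* Enforcer has a winning strategy from position (A = Avoider's vertices,
   B = Enforcer's vertices, av = true iff Avoider moves next), with [fuel]
   bounding the number of remaining moves. Avoider loses iff at the end the
   subgraph induced by A contains a copy of H. *)
Fixpoint enf_wins (k : nat) (EH : {set {set 'I_k}}) (n : nat)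
    (E : {set {set 'I_n}}) (a b : nat) (fuel : nat)
    (A B : {set 'I_n}) (av : bool) {struct fuel} : bool :=
  match fuel with
  | 0 => contains_copy EH E A
  | fuel'.+1 =>
    let U := ~: (A :|: B) in
    if U == set0 then contains_copy EH E A
    else if av then
      [forall M : {set 'I_n},
         legal_move a U M ==> enf_wins EH E a b fuel' (A :|: M) B false]
    else
      [exists M : {set 'I_n},
         legal_move b U M && enf_wins EH E a b fuel' A (B :|: M) true]
  end.

(* Enforcer wins the monotone (a:b) Avoider-Enforcer vertex H-game on
   G = ([n], E); [avoider_first] says who moves first.  Every move claims
   at least one vertex, so n+1 rounds of fuel suffice. *)
Definition enforcer_wins (k : nat) (EH : {set {set 'I_k}}) (n : nat)
    (E : {set {set 'I_n}}) (a b : nat) (avoider_first : bool) : bool :=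
  enf_wins EH E a b n.+1 set0 set0 avoider_first.

Definition gnp_prob (n : nat) (p : R) (P : {set {set 'I_n}} -> bool) : R :=
  foldr Rplus 0
    [seq (if P E then (p ^ #|E| * (1 - p) ^ (#|Kedges n| - #|E|)%N)
          else 0) | E <- enum (powerset (Kedges n))].

(* Random graph process: a uniformly random ordering of the edges of K_n. *)
Definition orderings (n : nat) : seq (seq {set 'I_n}) :=
  permutations (enum (Kedges n)).

Definition proc_graph (n : nat) (s : seq {set 'I_n}) (i : nat) : {set {set 'I_n}} :=
  [set e in take i s].

(* tau(G~, P) = min { i : G_i in P } (= size s + 1 if there is no such i) *)
Definition tau (n : nat) (s : seq {set 'I_n}) (P : {set {set 'I_n}} -> bool) : nat :=
  find (fun i => P (proc_graph s i)) (iota 0%N (size s).+1).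

Definition proc_prob (n : nat) (Q : seq {set 'I_n} -> bool) : R :=
  (INR (count Q (orderings n)) / INR (size (orderings n))).

(* Main.v *)
(** Enforcer's strategy on [N] disjoint copies of [H]: give an untouched copy with
    [i] vertices of Avoider the weight [(b+1)^i]; Enforcer always sacrifices the
    [b] lightest copies and everything outside the copies, so Avoider must
    multiply the weight of a heavier copy by [b+1] and the total never drops.
    Hence [(b+1)^(v(H)+1)] disjoint copies suffice. Conversely Avoider wins when
    there is no copy at all, so the threshold is that of containing [H], obtained
    from the first and second moments.

    For the hitting time, extra vertices that lie in no copy can be swallowed by
    the first move of either player. So for a fixed number of disjoint copies the
    winner is eventually constant in [n], and [N] is the least number of copies
    with which Enforcer eventually wins. For strictly balanced [H], the copies
    present shortly after the threshold are w.h.p. pairwise disjoint, and there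
    the game is decided by their number alone. *)

Require Import Defs.
From Stdlib Require Import Reals.
From mathcomp Require Import all_boot all_order all_fingroup all_algebra Rstruct zify ring.
Import Order.TTheory GRing.Theory Num.Theory.

Set Implicit Arguments.
Unset Strict Implicit.
Unset Printing Implicit Defensive.

(** * Monotone Avoider-Enforcer games *)

(** The exponent v(H)+1 comes from the weight cap: a copy weighs at most (b+1)^v(H), so a total
    above b(b+1)^v(H) keeps more than b copies live, and (b+1)^(v(H)+1) copies of weight at least 1
    start above that level.

    Absorbing surplus vertices is one-sided: it preserves a win of the player who moves first. That
    suffices to make the winner eventually constant, but the winner is never computed, and [N] may
    depend on who starts.

    G(n,p) and the process at a fixed time enter only through the probability that a given edge set
    is present, which depends on its size alone; one pair of moment bounds serves both. Disjointness
    of many copies is built in: the vertices are cut into groups and a copy is sought inside each.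

    For the hitting time a single time M is inspected. If by then there are more than [N] disjoint
    copies and no two distinct copies meet, then both properties agree at every time up to M and
    hold at M, so they are hit simultaneously. *)

Lemma imset_setD (T T' : finType) (h : T -> T') (A B : {set T}) :
  injective h -> h @: (A :\: B) = h @: A :\: h @: B.
Proof.
move=> hI; apply/setP => y; rewrite inE; apply/imsetP/andP.
  by case=> x /setDP[Ax Bx] ->; rewrite !mem_imset.
by case=> /[swap] /imsetP[x Ax ->]; rewrite mem_imset // => Bx; exists x; rewrite // inE Bx.
Qed.

Section SetGame.
Variables a b : nat.
Hypotheses (a_gt0 : (0 < a)%N) (b_gt0 : (0 < b)%N).

Definition set_move (T : finType) (c : nat) (U M : {set T}) : bool :=
  (M \subset U) && (minn c #|U| <= #|M|).

(** The recursion of [enf_wins] freed from graphs: any finite board and any predicate [W] on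
    Avoider's final set, so that boards can be embedded into one another and copies replaced by
    abstract blocks. *)
Fixpoint game_win (T : finType) (W : {set T} -> bool) (fuel : nat)
    (A B : {set T}) (av : bool) {struct fuel} : bool :=
  match fuel with
  | 0 => W A
  | fuel'.+1 =>
    let U := ~: (A :|: B) in
    if U == set0 then W A
    else if av then
      [forall M : {set T},
         set_move a U M ==> game_win W fuel' (A :|: M) B false]
    else
      [exists M : {set T},
         set_move b U M && game_win W fuel' A (B :|: M) true]
  end.

Lemma enf_winsE k (EH : {set {set 'I_k}}) n (E : {set {set 'I_n}}) fuel A B av :
  enf_wins EH E a b fuel A B av = game_win (contains_copy EH E) fuel A B av.
Proof.
elim: fuel A B av => [|fuel IH] A B av //=.
case: ifP => // _; case: av.
  by apply: eq_forallb => M; rewrite IH.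
by apply: eq_existsb => M; rewrite IH.
Qed.

Lemma set_move_card (T : finType) c (U M : {set T}) :
  0 < c -> U != set0 -> set_move c U M -> 0 < #|M|.
Proof. by move=> c0; rewrite -card_gt0 => U0 /andP[_]; lia. Qed.

Lemma unclaimed_avoider (T : finType) (A B M : {set T}) :
  M \subset ~: (A :|: B) ->
  #|~: (A :|: M :|: B)| + #|M| = #|~: (A :|: B)|.
Proof.
move=> sMU; have -> : ~: (A :|: M :|: B) = ~: (A :|: B) :\: M.
  by apply/setP => x; rewrite !inE; case: (x \in A); case: (x \in B); case: (x \in M).
by rewrite cardsD (setIidPr sMU) subnK ?subset_leq_card.
Qed.

Lemma unclaimed_enforcer (T : finType) (A B M : {set T}) :
  M \subset ~: (A :|: B) ->
  #|~: (A :|: (B :|: M))| + #|M| = #|~: (A :|: B)|.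
Proof.
by move=> sMU; rewrite setUA setUAC unclaimed_avoider.
Qed.

(** Every move on a nonempty rest claims a vertex, so fuel beyond the number of unclaimed vertices
    is never consumed. Boards of different sizes, hence of different initial fuel, become
    comparable. *)
Lemma game_win_fuel (T : finType) (W : {set T} -> bool) f1 f2 A B av :
  #|~: (A :|: B)| <= f1 -> #|~: (A :|: B)| <= f2 ->
  game_win W f1 A B av = game_win W f2 A B av.
Proof.
elim: f1 f2 A B av => [|f1 IH] [|f2] A B av //=.
- by rewrite leqn0 cards_eq0 => ->.
- by move=> _; rewrite leqn0 cards_eq0 => ->.
move=> le1 le2; case: ifPn => // U0; case: av.
  apply: eq_forallb => M; case: (boolP (set_move _ _ _)) => //= mM.
  have M0 := set_move_card a_gt0 U0 mM; case/andP: mM => /unclaimed_avoider e _.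
  by apply: IH; lia.
apply: eq_existsb => M; case: (boolP (set_move _ _ _)) => //= mM.
have M0 := set_move_card b_gt0 U0 mM; case/andP: mM => /unclaimed_enforcer e _.
by apply: IH; lia.
Qed.

Lemma game_win_mono (T : finType) (W W' : {set T} -> bool) fuel A B av :
  (forall X, W X -> W' X) ->
  game_win W fuel A B av -> game_win W' fuel A B av.
Proof.
move=> sW; elim: fuel A B av => [|fuel IH] A B av /=; first exact: sW.
case: ifP => _; first exact: sW.
case: av.
  move=> /forallP h; apply/forallP => M; apply/implyP => mM.
  by apply: IH; apply: (implyP (h M)).
move=> /existsP[M /andP[mM h]]; apply/existsP; exists M; rewrite mM; exact: IH.
Qed.

Lemma set_move_all (T : finType) c (U : {set T}) : set_move c U U.
Proof. by rewrite /set_move subxx geq_minr. Qed.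

Lemma game_win_already (T : finType) (W : {set T} -> bool) fuel (A B : {set T}) av :
  (forall X : {set T}, A \subset X -> W X) -> game_win W fuel A B av.
Proof.
elim: fuel A B av => [|fuel IH] A B av h /=; first exact: h.
case: ifP => _; first exact: h.
case: av.
  apply/forallP => M; apply/implyP => _; apply: IH => X sAX; apply: h.
  by apply: subset_trans sAX; apply: subsetUl.
by apply/existsP; exists (~: (A :|: B)); rewrite set_move_all; apply: IH.
Qed.

(** Follow one play of Enforcer's strategy: [W] holds for the set Avoider ends with, hence for the
    whole board. This yields Avoider's win on a graph without copies. *)
Lemma game_win_end (T : finType) (W : {set T} -> bool) fuel A B av :
  {homo W : X Y / X \subset Y >-> X ==> Y} ->
  game_win W fuel A B av -> W setT.
Proof.
move=> Wh; elim: fuel A B av => [|fuel IH] A B av /=.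
  by apply: (implyP (Wh _ _ _)); exact: subsetT.
case: ifP => _; first by apply: (implyP (Wh _ _ _)); exact: subsetT.
case: av.
  move=> /forallP/(_ (~: (A :|: B))); rewrite set_move_all; exact: IH.
by move=> /existsP[M /andP[_]]; exact: IH.
Qed.

(* [h] identifies the unclaimed vertices of the two games; [Z] collects the
   vertices outside the image of [h] that belong to Avoider. *)
Lemma game_win_transport (T T' : finType) (h : T -> T') (Z : {set T'})
    (W : {set T} -> bool) (W' : {set T'} -> bool) fuel
    (A B : {set T}) (A' B' : {set T'}) av :
  injective h -> (forall X : {set T}, W' (h @: X :|: Z) = W X) ->
  A' = h @: A :|: Z -> ~: (A' :|: B') = h @: (~: (A :|: B)) ->
  game_win W' fuel A' B' av = game_win W fuel A B av.
Proof.
move=> hI eW; elim: fuel A B A' B' av => [|fuel IH] A B A' B' av eA eU /=.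
  by rewrite eA eW.
rewrite eU imset_eq0; case: ifP => _; first by rewrite eA eW.
set U := ~: (A :|: B) in eU *.
have mE c (M : {set T}) : set_move c (h @: U) (h @: M) = set_move c U M.
  rewrite /set_move !card_imset //; congr (_ && _).
  apply/subsetP/subsetP => s x; last first.
    by case/imsetP => y My ->; rewrite imset_f // s.
  by move=> Mx; have := s _ (imset_f h Mx); rewrite mem_imset.
have mI c (M' : {set T'}) : set_move c (h @: U) M' -> exists M : {set T}, M' = h @: M.
  case/andP => /subsetP s _; exists (h @^-1: M'); apply/setP => y; apply/idP/imsetP.
    by move=> My; case/imsetP: (s _ My) => x _ yx; exists x; rewrite // inE -yx.
  by case=> x; rewrite inE => My ->.
have UA (M : {set T}) : M \subset U -> ~: (A' :|: h @: M :|: B') = h @: (~: (A :|: M :|: B)).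
  move=> sM; have -> : ~: (A' :|: h @: M :|: B') = ~: (A' :|: B') :\: h @: M.
    by apply/setP => x; rewrite !inE; case: (x \in A'); case: (x \in B'); case: (_ \in h @: M).
  have -> : ~: (A :|: M :|: B) = U :\: M.
    by apply/setP => x; rewrite !inE; case: (x \in A); case: (x \in B); case: (x \in M).
  by rewrite eU imset_setD.
have UB (M : {set T}) : M \subset U -> ~: (A' :|: (B' :|: h @: M)) = h @: (~: (A :|: (B :|: M))).
  by move=> sM; rewrite setUA setUAC UA // setUAC setUA.
have AA (M : {set T}) : A' :|: h @: M = h @: (A :|: M) :|: Z.
  by rewrite eA imsetU setUAC.
case: av.
  apply/forallP/forallP => H M; apply/implyP => mM.
    have := H (h @: M); rewrite mE mM /= (IH (A :|: M) B) //.
    by apply: UA; case/andP: mM.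
  have [M1 e] := mI _ _ mM; rewrite e mE in mM *.
  have := H M1; rewrite mM /= -(IH _ _ (A' :|: h @: M1) B') //.
  by apply: UA; case/andP: mM.
apply/existsP/existsP => -[M /andP[mM H]].
  have [M1 e] := mI _ _ mM; rewrite e mE in mM H *.
  exists M1; rewrite mM -(IH _ _ A' (B' :|: h @: M1)) // UB //.
  by case/andP: mM.
exists (h @: M); rewrite mE mM (IH A (B :|: M)) //.
by apply: UB; case/andP: mM.
Qed.

Lemma start_neq0 (S : finType) : 0 < #|S| -> (~: (set0 :|: set0) == set0 :> {set S}) = false.
Proof. by move=> S0; rewrite setU0 setC0 -cards_eq0 cardsT; lia. Qed.

(** * Boards with surplus vertices *)

Section MoreVertices.
Variables (T T' : finType) (h : T -> T').
Variables (W : {set T} -> bool) (W' : {set T'} -> bool).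
Hypotheses (T_gt0 : 0 < #|T|) (h_inj : injective h).
Hypothesis WW' : forall (X : {set T}) (Z : {set T'}),
  Z \subset ~: (h @: setT) -> W' (h @: X :|: Z) = W X.

Let Z0 : {set T'} := ~: (h @: setT).

Lemma card_surplus : #|Z0| + #|T| = #|T'|.
Proof. by rewrite -(cardsC (h @: setT)) addnC card_imset // cardsT. Qed.

(** The required size [minn c #|U|] grows by at most the number of surplus vertices when the board
    does, so adding all of them keeps a first move legal. *)
Lemma move_with_rest c (M : {set T}) :
  set_move c (~: (set0 :|: set0)) M ->
  set_move c (~: (set0 :|: set0)) (h @: M :|: Z0).
Proof.
rewrite /set_move !setU0 !setC0 !subsetT /= !cardsT => H.
rewrite cardsU card_imset //; have -> : h @: M :&: Z0 = set0.
  apply/eqP; rewrite setI_eq0 disjoints_subset setCK imsetS //; exact: subsetT.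
by rewrite cards0; have := card_surplus; lia.
Qed.

(* The surplus vertices are absorbed into the first move. *)
Lemma game_win_more_enforcer :
  game_win W #|T|.+1 set0 set0 false -> game_win W' #|T'|.+1 set0 set0 false.
Proof.
rewrite /= !start_neq0 //; last by have := card_surplus; lia.
move=> /existsP[M /andP[mM H]]; apply/existsP; exists (h @: M :|: Z0).
rewrite move_with_rest //=.
rewrite (game_win_transport (h := h) (Z := set0) (W := W) _ (A := set0) (B := M)) //.
- rewrite set0U in H; rewrite -(game_win_fuel _ (f1 := #|T|)) //.
    by rewrite max_card.
  exact: leq_trans (max_card _) (leq_card h h_inj).
- by move=> X; apply: WW'; apply: sub0set.
- by rewrite imset0 setU0.
rewrite !set0U setCU setCK.
by rewrite setIC -setDE -imset_setD ?setTD.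
Qed.

(** Here the surplus ends up with Avoider, so the transport carries it along as [Z := Z0]; it costs
    him nothing because [W'] ignores vertices outside the image of [h]. *)
Lemma game_win_more_avoider :
  ~~ game_win W #|T|.+1 set0 set0 true -> ~~ game_win W' #|T'|.+1 set0 set0 true.
Proof.
rewrite /= !start_neq0 //; last by have := card_surplus; lia.
move=> /forallPn[M]; rewrite negb_imply => /andP[mM H].
apply/forallPn; exists (h @: M :|: Z0); rewrite negb_imply.
rewrite move_with_rest //=.
rewrite (game_win_transport (h := h) (Z := Z0) (W := W) _ (A := M) (B := set0)) //.
- rewrite set0U in H; rewrite -(game_win_fuel _ (f1 := #|T|)) //.
    by rewrite max_card.
  exact: leq_trans (max_card _) (leq_card h h_inj).
- by move=> X; apply: WW'.
- by rewrite set0U.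
rewrite !setU0 !set0U setCU setCK.
by rewrite setIC -setDE -imset_setD ?setTD.
Qed.

End MoreVertices.

(** * The game on [N] disjoint blocks of [k] vertices, and Enforcer's potential *)

Definition full_block (T : finType) N k (f : 'I_N * 'I_k -> T) (A : {set T}) : bool :=
  [exists j, [forall x, f (j, x) \in A]].

Lemma full_block_mono (T : finType) N k (f : 'I_N * 'I_k -> T) (A A' : {set T}) :
  A \subset A' -> full_block f A -> full_block f A'.
Proof.
move=> /subsetP sA /existsP[j /forallP h]; apply/existsP; exists j.
by apply/forallP => x; apply: sA.
Qed.

(** Greedy choice: [c] times, a lightest remaining element is added. *)
Lemma lightest_subset (I : finType) (w : I -> nat) (J : {set I}) c :
  c <= #|J| -> exists I0 : {set I},
    [/\ I0 \subset J, #|I0| = c & forall i j, i \in I0 -> j \in J :\: I0 -> w i <= w j].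
Proof.
elim: c => [|c IH] cJ.
  by exists set0; split; rewrite ?sub0set ?cards0 // => i j; rewrite inE.
have [I0 [sI0 cI0 h]] := IH (ltnW cJ).
have /card_gt0P[i0 i0P] : 0 < #|J :\: I0| by rewrite cardsD (setIidPr sI0); lia.
have [i1 i1P i1min] := arg_minnP w i0P.
exists (i1 |: I0); split.
- by rewrite subUset sI0 sub1set andbT; case/setDP: i1P.
- by rewrite cardsU1 cI0; case/setDP: i1P => _ ->.
move=> i j iI jJ; have jJ0 : j \in J :\: I0.
  by move: jJ; rewrite !inE negb_or => /andP[/andP[_ ->] ->].
by case/setU1P: iI => [->|iI]; [apply: i1min | apply: h].
Qed.

Section Potential.
Variables (T : finType) (N k : nat) (f : 'I_N * 'I_k -> T).
Hypothesis f_inj : injective f.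

Definition block_weight (A : {set T}) (j : 'I_N) := b.+1 ^ #|[set x | f (j, x) \in A]|.

Lemma block_weight_mono (A A' : {set T}) j :
  A \subset A' -> block_weight A j <= block_weight A' j.
Proof.
move=> /subsetP sA; rewrite leq_exp2l //.
by apply/subset_leq_card/subsetP => x; rewrite !inE; apply: sA.
Qed.

Lemma block_weight_incr (A A' : {set T}) j x :
  A \subset A' -> f (j, x) \in A' -> f (j, x) \notin A ->
  b.+1 * block_weight A j <= block_weight A' j.
Proof.
move=> /subsetP sA A'x Ax; rewrite -expnS leq_exp2l //.
apply/proper_card/properP; split.
  by apply/subsetP => y; rewrite !inE; apply: sA.
by exists x; rewrite !inE.
Qed.

Lemma block_weight_max (A : {set T}) j : block_weight A j <= b.+1 ^ k.
Proof.
by rewrite /block_weight leq_exp2l //; apply: leq_trans (max_card _) _; rewrite card_ord.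
Qed.

(* Enforcer gives up the [b] lightest live blocks together with everything
   outside the live blocks; Avoider must then multiply the weight of some
   surviving, hence heavier, block by [b + 1], which makes up for the loss. *)
Lemma potential_win fuel (A B : {set T}) (J : {set 'I_N}) :
  #|~: (A :|: B)| <= fuel ->
  (forall j x, j \in J -> f (j, x) \notin B) ->
  b * b.+1 ^ k < \sum_(j in J) block_weight A j ->
  game_win (full_block f) fuel A B false.
Proof.
elim/ltn_ind: fuel A B J => fuel IH A B J leU JB Jw.
have [[j jA]|noA] := altP (@existsP _ (fun j => [forall x, f (j, x) \in A])).
  apply: game_win_already => X sAX; apply: full_block_mono sAX _.
  by apply/existsP; exists j.
have free j : j \in J -> exists x, f (j, x) \in ~: (A :|: B).
  move=> Jj; move: noA; rewrite negb_exists => /forallP/(_ j); rewrite negb_forall.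
  by case/existsP => x Ax; exists x; rewrite !inE negb_or Ax JB.
(* At most [b] live blocks would weigh at most [b (b+1)^k] in total. *)
have bJ : b < #|J|.
  rewrite ltnNge; apply/negP => Jb; move: Jw; rewrite ltnNge => /negP; apply.
  apply: leq_trans (leq_mul Jb (leqnn _)); rewrite -sum_nat_const.
  by apply: leq_sum => j _; apply: block_weight_max.
have [I0 [sI0 cI0 I0min]] := lightest_subset (block_weight A) (ltnW bJ).
pose D := J :\: I0; pose U := ~: (A :|: B).
pose M := [set v in U | [forall j in D, forall x, f (j, x) != v]].
have sMU : M \subset U by apply/subsetP => v; rewrite inE => /andP[].
(* Each sacrificed block still has a free vertex, and disjointness makes these [b] vertices
   distinct, so the move is large enough. *)
have Mb : b <= #|M|.
  have pickU j : exists x, j \in J -> f (j, x) \in U.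
    have [jJ|jJ] := boolP (j \in J); first by have [x xP] := free j jJ; exists x.
    by have /card_gt0P[j0 /free[x _]] : 0 < #|J| by [lia]; exists x.
  have [p pP] := fin_all_exists pickU.
  pose g j := f (j, p j).
  rewrite -cI0 -(card_imset _ (_ : injective g)); last by move=> i j /f_inj[].
  apply/subset_leq_card/subsetP => _ /imsetP[i iI ->]; rewrite inE.
  have iJ := subsetP sI0 _ iI; rewrite /g pP //=.
  apply/forall_inP => j; rewrite inE => /andP[jI _]; apply/forallP => y.
  by apply/eqP => /f_inj[e _]; rewrite e iI in jI.
(* A surviving block keeps a free vertex, so the game is not over after Enforcer's move and Avoider
   has to answer; the induction therefore advances by two moves. *)
have [j0 j0D] : exists j0, j0 \in D.
  by apply/card_gt0P; rewrite cardsD (setIidPr sI0) cI0; lia.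
have [x0 x0U] : exists x, f (j0, x) \in U by apply: free; case/setDP: j0D.
case: fuel IH leU => [|fuel] IH leU.
  by move: leU; rewrite leqn0 cards_eq0 => /eqP U0; rewrite /U U0 inE in x0U.
rewrite /= -/U; case: ifPn => [/eqP U0|U0]; first by rewrite U0 inE in x0U.
apply/existsP; exists M; rewrite /set_move sMU geq_min Mb /=.
have leU' := unclaimed_enforcer sMU; rewrite -/U in leU'.
set V := ~: (A :|: (B :|: M)) in leU'.
have V0 : f (j0, x0) \in V.
  move: x0U; rewrite !inE !negb_or => /andP[-> ->] /=.
  by apply/forall_inPn; exists j0 => //; apply/forallPn; exists x0; rewrite negbK.
have V_gt0 : 0 < #|V| by apply/card_gt0P; exists (f (j0, x0)).
case: fuel IH leU => [|fuel] IH leU; first by rewrite -/U in leU; lia.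
rewrite /= -/V.
case: ifPn => [/eqP V00|Vn0]; first by rewrite V00 inE in V0.
apply/forallP => M2; apply/implyP => mM2.
have M2gt0 := set_move_card a_gt0 Vn0 mM2; have /andP[sM2 _] := mM2.
have leU2 := unclaimed_avoider sM2.
rewrite -/V in leU2; rewrite -/U in leU.
apply: (IH fuel _ _ _ D) => //; first lia.
- move=> j x jD; rewrite inE negb_or JB /=; last by case/setDP: jD.
  rewrite inE negb_and; apply/orP; right; apply/forall_inPn; exists j => //.
  by apply/forallPn; exists x; rewrite negbK.
case/card_gt0P: M2gt0 => v vM2; have vV := subsetP sM2 _ vM2.
(* Only vertices of surviving blocks are left, so whatever Avoider takes enlarges some surviving
   block. *)
have [j1 [x1 [j1D ev]]] : exists j1 x1, j1 \in D /\ f (j1, x1) = v.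
  move: vV; rewrite !inE !negb_or => /and3P[-> ->] /= /forall_inPn[j jD /forallPn[x]].
  by rewrite negbK => /eqP e; exists j, x.
apply: leq_trans Jw _.
(* The balance: the lost blocks weigh at most [b] times the old weight of [j1], and [j1] alone gains
   at least that much. *)
rewrite (big_setID I0) /= (setIidPr sI0) -/D !(bigD1 (P := mem D) j1) //.
have h1 : \sum_(i in I0) block_weight A i <= b * block_weight A j1.
  by rewrite -cI0 -sum_nat_const; apply: leq_sum => i iI; apply: I0min.
have h2 : b.+1 * block_weight A j1 <= block_weight (A :|: M2) j1.
  apply: (@block_weight_incr _ _ _ x1); first exact: subsetUl.
    by rewrite ev inE vM2 orbT.
  by rewrite ev; move: vV; rewrite !inE !negb_or => /andP[].
have h3 : \sum_(i in D | i != j1) block_weight A i <=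
          \sum_(i in D | i != j1) block_weight (A :|: M2) i.
  by apply: leq_sum => i _; apply: block_weight_mono; apply: subsetUl.
rewrite addnA; apply: leq_add h3; apply: leq_trans h2; rewrite mulSn addnC leq_add2l.
by apply: leq_trans h1 _.
Qed.

(** Every weight is at least 1 whatever Avoider holds, so the total is at least
    [N >= (b+1)^(k+1) > b (b+1)^k], even after an opening move by Avoider. *)
Lemma many_blocks_win av : 0 < k -> b.+1 ^ k.+1 <= N ->
  game_win (full_block f) #|T|.+1 set0 set0 av.
Proof.
move=> k_gt0 Nb.
have N_w A : b * b.+1 ^ k < \sum_(j in [set: 'I_N]) block_weight A j.
  apply: leq_trans (_ : N <= _).
    apply: leq_trans Nb; rewrite expnS mulSn -[X in X < _]add0n ltn_add2r expn_gt0; lia.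
  rewrite -[X in X <= _]muln1 -{1}[N]card_ord -cardsT -sum_nat_const.
  by apply: leq_sum => j _; rewrite expn_gt0.
have N_gt0 : 0 < N by apply: leq_trans Nb; rewrite expn_gt0.
case: av; last first.
  apply: (@potential_win _ _ _ setT) => //; first by rewrite (leq_trans (max_card _)).
  by move=> j x _; rewrite inE.
have v : T := f (Ordinal N_gt0, Ordinal k_gt0).
rewrite /= start_neq0; last by apply/card_gt0P; exists v.
apply/forallP => M; apply/implyP => _.
apply: (@potential_win _ _ _ setT) => //; first by rewrite (leq_trans (max_card _)).
by move=> j x _; rewrite inE.
Qed.
End Potential.

(** * The eventual winner for a fixed number of blocks *)

Lemma inj_extend (I T T' : finType) (f : I -> T) (f' : I -> T') :
  injective f -> injective f' -> #|T| <= #|T'| ->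
  exists h : T -> T', injective h /\ forall i, h (f i) = f' i.
Proof.
move=> fI f'I leT.
(* Both types are listed with the images of [f] and [f'] in front, in the same order; [h] matches
   equal positions. *)
pose l := codom f ++ enum (~: (f @: setT)); pose l' := codom f' ++ enum (~: (f' @: setT)).
have mem_l t : t \in l.
  rewrite mem_cat mem_enum inE; apply/orP.
  have [/imsetP[i _ ->]|] := boolP (t \in f @: setT); first by left; apply: codom_f.
  by right.
have uniq_l' : uniq l'.
  rewrite cat_uniq enum_uniq map_inj_uniq ?enum_uniq // andbT; apply/hasPn => y.
  rewrite mem_enum inE => /negP ny; apply/negP => /codomP[i e]; apply: ny.
  by rewrite e imset_f.
have size_l : size l <= size l'.
  rewrite !size_cat !size_codom leq_add2l -!cardE.
  have := cardsC (f @: setT); have := cardsC (f' @: setT).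
  by rewrite !card_imset // !cardsT; lia.
(* [nth] needs a default element of [T']; if there is none, [T] is empty as well. *)
case: (pickP (@predT T')) => [t0 _|T'0]; last first.
  have T0 : T -> False.
    move=> t; have : 0 < #|T'| by apply: leq_trans leT; apply/card_gt0P; exists t.
    by rewrite (eq_card0 T'0).
  by exists (fun t => False_rect _ (T0 t)); split=> [t|i]; [case: (T0 t) | case: (T0 (f i))].
exists (fun t => nth t0 l' (index t l)); split=> [t u /eqP|i].
  have lt_l v : index v l < size l' by apply: leq_trans size_l; rewrite index_mem.
  rewrite nth_uniq // => /eqP e.
  by rewrite -(nth_index t (mem_l t)) e nth_index.
have fi : f i \in codom f by apply: codom_f.
rewrite index_cat fi nth_cat size_codom -(size_codom f) index_mem fi.
rewrite /codom /image_mem index_map // (nth_map i) ?nth_index ?mem_enum //.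
by rewrite index_mem mem_enum.
Qed.

Definition ev_outcome (k : nat) (av : bool) (N : nat) (win : bool) : Prop :=
  exists n0, forall n (f : 'I_N * 'I_k -> 'I_n), n0 <= n -> injective f ->
    game_win (full_block f) n.+1 set0 set0 av = win.

Lemma full_block_transport N k (T T' : finType) (h : T -> T')
    (f : 'I_N * 'I_k -> T) (f' : 'I_N * 'I_k -> T') (X : {set T}) (Z : {set T'}) :
  injective h -> (forall i, h (f i) = f' i) -> Z \subset ~: (h @: setT) ->
  full_block f' (h @: X :|: Z) = full_block f X.
Proof.
move=> hI hf /subsetP sZ; apply: eq_existsb => j; apply: eq_forallb => x.
rewrite -hf inE mem_imset // orbC; case: (boolP (_ \in Z)) => // /sZ.
by rewrite inE imset_f.
Qed.

(** If the first player wins on some nonempty board, the same holds on every larger board with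
    equally many blocks, by absorbing the surplus. Otherwise the second player wins on all nonempty
    boards. *)
Lemma ev_outcome_dichotomy k av N :
  ev_outcome k av N true \/ ev_outcome k av N false.
Proof.
have key n n' (f : 'I_N * 'I_k -> 'I_n) (f' : 'I_N * 'I_k -> 'I_n') :
    0 < n <= n' -> injective f -> injective f' ->
    game_win (full_block f) n.+1 set0 set0 av = ~~ av ->
    game_win (full_block f') n'.+1 set0 set0 av = ~~ av.
  move=> /andP[n0 le_n] fI f'I.
  have [||//|h [hI hf]] := @inj_extend _ _ _ f f'; rewrite ?card_ord //.
  have WW' X Z := @full_block_transport _ _ _ _ h f f' X Z hI hf.
  case: av => H.
    apply/negbTE; have := @game_win_more_avoider _ _ h _ _ _ hI WW'.
    by rewrite !card_ord; apply => //; rewrite H.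
  have := @game_win_more_enforcer _ _ h _ _ _ hI WW'.
  by rewrite !card_ord; apply.
have [[n [f [n0 fI H]]]|no] := Classical_Prop.classic (exists n (f : 'I_N * 'I_k -> 'I_n),
   [/\ 0 < n, injective f & game_win (full_block f) n.+1 set0 set0 av = ~~ av]).
  suff : ev_outcome k av N (~~ av) by case: av {key H} => /=; [right | left].
  by exists n => n' f' le_n f'I; apply: (key n n' f f') => //; rewrite n0.
suff : ev_outcome k av N av by case: av {key no}; [left | right].
exists 1 => n f n0 fI; case E: (game_win _ _ _ _ _); case: av E {key} no => //= E no.
  by exfalso; apply: no; exists n, f.
by exfalso; apply: no; exists n, f.
Qed.

(** Descent from [(b+1)^(k+1)] to a least winning count. Nothing is asserted about counts above [N];
    with more copies at hand, Enforcer will use only [N] of them. *)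
Lemma ev_outcome_threshold k av : 0 < k ->
  exists N, ev_outcome k av N true /\ forall j, j < N -> ev_outcome k av j false.
Proof.
move=> k0; have : ev_outcome k av (b.+1 ^ k.+1) true.
  exists 0 => n f _ fI; have := @many_blocks_win _ _ _ f fI av k0 (leqnn _).
  by rewrite card_ord.
elim/ltn_ind: (b.+1 ^ k.+1) => N IH H.
have [[j [jN Hj]]|no] := Classical_Prop.classic (exists j, j < N /\ ev_outcome k av j true).
  exact: IH jN Hj.
exists N; split=> // j jN; case: (ev_outcome_dichotomy k av j) => // Hj.
by case: no; exists j.
Qed.

End SetGame.

(** * Copies of a graph *)

Section Copies.
Variables (k : nat) (EH : {set {set 'I_k}}) (n : nat).
Implicit Types (E : {set {set 'I_n}}) (f g : {ffun 'I_k -> 'I_n}).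

Definition edge_image f : {set {set 'I_n}} := [set f @: (e : {set 'I_k}) | e in EH].

Definition embeds E f : bool := injectiveb f && (edge_image f \subset E).

(** A copy is the pair of vertex and edge image, so embeddings that differ by an automorphism are
    one copy, and only distinct copies are required to be disjoint. *)
Definition copies_disjoint E : Prop := forall f g, embeds E f -> embeds E g ->
  forall x y, f x = g y -> (f @: setT, edge_image f) = (g @: setT, edge_image g).

Lemma edge_image_sub E f :
  (edge_image f \subset E) = [forall e in EH, f @: (e : {set 'I_k}) \in E].
Proof.
apply/subsetP/forall_inP => [s e eH|s _ /imsetP[e eH ->]]; last exact: s.
exact/s/imset_f.
Qed.

Lemma embeds_mono E E' f : E \subset E' -> embeds E f -> embeds E' f.
Proof. by move=> sE /andP[fI s]; rewrite /embeds fI (subset_trans s). Qed.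

Lemma copies_disjoint_mono E E' : E \subset E' -> copies_disjoint E' -> copies_disjoint E.
Proof. by move=> sE h f g /(embeds_mono sE) ef /(embeds_mono sE) eg; apply: h. Qed.

Lemma contains_copyP E (A : {set 'I_n}) :
  reflect (exists2 f, embeds E f & forall x, f x \in A) (contains_copy EH E A).
Proof.
apply: (iffP existsP) => [[f /and3P[fI /forallP fA fE]]|[f /andP[fI fE] fA]]; exists f => //.
  by rewrite /embeds fI edge_image_sub.
by rewrite fI -edge_image_sub fE andbT; apply/forallP.
Qed.

Lemma contains_copy_mono E (A A' : {set 'I_n}) :
  A \subset A' -> contains_copy EH E A -> contains_copy EH E A'.
Proof.
move=> /subsetP sA /contains_copyP[f fE fA]; apply/contains_copyP.
by exists f => // x; apply: sA.
Qed.

Lemma num_copiesE E :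
  num_copies EH E = #|[set (f @: setT, edge_image f) | f : {ffun 'I_k -> 'I_n} & embeds E f]|.
Proof.
apply: eq_card => -[S F]; rewrite inE; apply/existsP/imsetP => /=.
  case=> f /and4P[fI /eqP -> /eqP -> sF]; exists f => //.
  by rewrite inE /embeds fI.
case=> f; rewrite inE => /andP[fI sF] [-> ->]; exists f.
by rewrite fI !eqxx.
Qed.

Definition block_map N (f : 'I_N * 'I_k -> 'I_n) j : {ffun 'I_k -> 'I_n} := [ffun x => f (j, x)].

Lemma num_copies_blocks E N (f : 'I_N * 'I_k -> 'I_n) :
  0 < k -> injective f -> (forall j, embeds E (block_map f j)) -> N <= num_copies EH E.
Proof.
move=> k0 fI fE; rewrite num_copiesE.
pose c j := (block_map f j @: setT, edge_image (block_map f j)).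
have cI : injective c.
  move=> i j [/setP/(_ (f (i, Ordinal k0))) + _].
  have -> : f (i, Ordinal k0) \in block_map f i @: setT.
    by apply/imsetP; exists (Ordinal k0); rewrite ?ffunE.
  by move/esym/imsetP => [x _]; rewrite ffunE => /fI[].
rewrite -[X in X <= _]card_ord -(card_imset _ cI); apply/subset_leq_card/subsetP.
by move=> _ /imsetP[j _ ->]; apply: imset_f; rewrite inE.
Qed.

(** One embedding is chosen for each of the first [N] copies in an enumeration; disjointness of the
    copies makes the joint map injective. The last clause says that with [N] exact the blocks
    exhaust all copies, which Avoider's side of the game relies on. *)
Lemma blocks_of_copies E N : copies_disjoint E -> N <= num_copies EH E ->
  exists f : 'I_N * 'I_k -> 'I_n, [/\ injective f, forall j, embeds E (block_map f j)
    & num_copies EH E <= N -> forall g, embeds E g ->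
        exists j, g @: setT = block_map f j @: setT].
Proof.
rewrite num_copiesE => disj leN; set Cp := [set _ | _ in _] in leN *.
have exf (j : 'I_N) : exists f,
    embeds E f /\ enum_val (widen_ord leN j) = (f @: setT, edge_image f).
  by have /imsetP[f] := enum_valP (widen_ord leN j); rewrite inE => fE ->; exists f.
have [F FP] := fin_all_exists exf.
exists (fun jx => F jx.1 jx.2); split.
- move=> [i x] [j y] /= e.
  have [Ei vi] := FP i; have [Ej vj] := FP j.
  have ij : i = j.
    have := disj _ _ Ei Ej _ _ e; rewrite -vi -vj => /enum_val_inj/(congr1 val) /= ?.
    exact: val_inj.
  by move: e; rewrite ij; case/andP: Ej => /injectiveP FI _ /FI ->.
- by move=> j; have [Ej _] := FP j; rewrite (_ : block_map _ _ = F j) //; apply/ffunP => x; rewrite ffunE.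
move=> geN g gE; have gC : (g @: setT, edge_image g) \in Cp by apply: imset_f; rewrite inE.
have lt : enum_rank_in gC (g @: setT, edge_image g) < N by apply: leq_trans geN.
exists (Ordinal lt); have [_] := FP (Ordinal lt).
rewrite (_ : widen_ord _ _ = enum_rank_in gC (g @: setT, edge_image g)); last exact: val_inj.
rewrite enum_rankK_in // => -[e _]; apply: etrans e _; apply: eq_imset => x.
by rewrite ffunE.
Qed.

End Copies.

(** * From blocks back to graphs *)

Section EnforcerWins.
Variables (a b : nat).
Hypotheses (a_gt0 : 0 < a) (b_gt0 : 0 < b).

Lemma enforcer_winsE k (EH : {set {set 'I_k}}) n (E : {set {set 'I_n}}) av :
  enforcer_wins EH E a b av = game_win a b (contains_copy EH E) n.+1 set0 set0 av.
Proof. exact: enf_winsE. Qed.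

Lemma enforcer_wins_copy k (EH : {set {set 'I_k}}) n (E : {set {set 'I_n}}) av :
  enforcer_wins EH E a b av -> contains_copy EH E setT.
Proof.
rewrite enforcer_winsE; apply: game_win_end => X Y sXY.
by apply/implyP; apply: contains_copy_mono.
Qed.

Lemma full_block_copy k (EH : {set {set 'I_k}}) n (E : {set {set 'I_n}}) N
    (f : 'I_N * 'I_k -> 'I_n) A :
  (forall j, embeds EH E (block_map f j)) -> full_block f A -> contains_copy EH E A.
Proof.
move=> fE /existsP[j /forallP fA]; apply/contains_copyP; exists (block_map f j) => // x.
by rewrite ffunE.
Qed.

Lemma enforcer_wins_blocks k (EH : {set {set 'I_k}}) n (E : {set {set 'I_n}}) av
    (f : 'I_(b.+1 ^ k.+1) * 'I_k -> 'I_n) :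
  0 < k -> injective f -> (forall j, embeds EH E (block_map f j)) ->
  enforcer_wins EH E a b av.
Proof.
move=> k0 fI fE; rewrite enforcer_winsE.
apply: (@game_win_mono _ _ _ (full_block f)); first by move=> X; apply: full_block_copy.
by have := @many_blocks_win a b a_gt0 b_gt0 _ _ _ f fI av k0 (leqnn _); rewrite card_ord.
Qed.

(** With at least [N] copies, Enforcer plays on [N] of them, since a full block contains a copy.
    With fewer, the blocks are all the copies, so conversely a copy in Avoider's set fills a block
    and the losing outcome for that count applies. Only vertex sets matter, whence [N] and [n0]
    serve every [EH] on [k] vertices. *)
Lemma enforcer_wins_iff_copies k av : 0 < k -> exists N n0,
  forall (EH : {set {set 'I_k}}) n (E : {set {set 'I_n}}),
    n0 <= n -> copies_disjoint EH E ->
    enforcer_wins EH E a b av = has_N_copies EH N E.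
Proof.
move=> k0; have [N [[n1 win] lose]] := ev_outcome_threshold a_gt0 b_gt0 av k0.
have /fin_all_exists[n2 lose'] (j : 'I_N) := lose j (ltn_ord j).
exists N, (maxn n1 (\max_j n2 j)) => EH n E; rewrite geq_max => /andP[len1 len2] disj.
rewrite enforcer_winsE /has_N_copies; case: leqP => [leN|ltN].
  have [f [fI fE _]] := blocks_of_copies disj leN.
  apply: (@game_win_mono _ _ _ (full_block f)); first by move=> X; apply: full_block_copy.
  exact: win.
have [f [fI _ fall]] := blocks_of_copies disj (leqnn _).
have lt2 : n2 (Ordinal ltN) <= n by apply: leq_trans len2; apply: leq_bigmax.
apply/negbTE; apply: contraFN (lose' (Ordinal ltN) n f lt2 fI).
apply: game_win_mono => X /contains_copyP[g gE gX].
have [j gj] := fall (leqnn _) g gE; apply/existsP; exists j; apply/forallP => x.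
have : f (j, x) \in g @: setT by rewrite gj; apply/imsetP; exists x; rewrite ?ffunE.
by case/imsetP => y _ ->.
Qed.

(** The empty graph has a copy in every set; for one vertex, single vertices are blocks and
    [(b+1)^2] of them are [(b+1)^(k+1)] with [k = 1]. *)
Lemma edgeless_enforcer_wins k n (E : {set {set 'I_n}}) av :
  k <= 1 -> b.+1 ^ 2 <= n -> enforcer_wins (set0 : {set {set 'I_k}}) E a b av.
Proof.
move=> k1 len.
have emb0 (f : {ffun 'I_k -> 'I_n}) : injectiveb f -> embeds set0 E f.
  by rewrite /embeds /edge_image imset0 sub0set => ->.
have inj1 (f : {ffun 'I_k -> 'I_n}) : injectiveb f.
  by apply/injectiveP => -[i ?] [j ?] _; apply: val_inj => /=; lia.
case: (posnP k) => [k0|k0].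
  rewrite enforcer_winsE; apply: game_win_already => X _; apply/contains_copyP.
  have n0 : 0 < n by apply: leq_trans len; rewrite expn_gt0.
  exists [ffun=> Ordinal n0]; first exact/emb0.
  by move=> [i ?]; exfalso; lia.
have ek : k = 1 by lia.
have lek : b.+1 ^ k.+1 <= n by rewrite ek.
apply: (@enforcer_wins_blocks _ _ _ _ _ (fun jx => widen_ord lek jx.1)) => //.
  move=> [i [x xk]] [j [y yk]] /(congr1 val) /= e.
  by congr (_, _); apply: val_inj => //=; lia.
by move=> j; apply/emb0/inj1.
Qed.
End EnforcerWins.

(** * Second moment *)

Local Open Scope ring_scope.

Section FiniteProbability.
Variables (R : realFieldType) (X : eqType) (r : seq X) (w : X -> R).
Hypotheses (w_ge0 : forall x, 0 <= w x) (w_sum1 : \sum_(x <- r) w x = 1).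

Definition Pr (Q : pred X) : R := \sum_(x <- r | Q x) w x.

Lemma Pr_compl Q : Pr (fun x => ~~ Q x) = 1 - Pr Q.
Proof. by rewrite -w_sum1 (bigID Q) /= addrC addrK. Qed.

Lemma Pr_mono (Q Q' : pred X) : {in r, forall x, Q x -> Q' x} -> Pr Q <= Pr Q'.
Proof.
move=> s; rewrite /Pr big_seq_cond [leRHS]big_mkcond [leRHS]big_seq /= big_mkcondr /=.
by apply: ler_sum => x xr; case: ifP => [/(s _ xr) ->|_] //; case: ifP.
Qed.

Lemma Pr_union (I : finType) (P : pred I) (B : I -> pred X) :
  Pr (fun x => [exists i in P, B i x]) <= \sum_(i in P) Pr (B i).
Proof.
rewrite /Pr (exchange_big_dep predT) //= big_mkcond /=; apply: ler_sum => x _.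
case: ifP => [/existsP[i /andP[Pi Bi]]|_]; last exact: sumr_ge0.
rewrite (bigD1 i) /=; first by rewrite lerDl sumr_ge0.
by rewrite Pi.
Qed.

(** Chebyshev's inequality with the division cleared: where [Y] vanishes, the squared deviation is
    [mu ^+ 2]. *)
Lemma second_moment_zero (Y : X -> R) (mu : R) : \sum_(x <- r) w x * Y x = mu ->
  Pr (fun x => Y x == 0) * mu ^+ 2 <= \sum_(x <- r) w x * Y x ^+ 2 - mu ^+ 2.
Proof.
move=> mu_def.
have -> : \sum_(x <- r) w x * Y x ^+ 2 - mu ^+ 2 = \sum_(x <- r) w x * (Y x - mu) ^+ 2.
  have -> : \sum_(x <- r) w x * (Y x - mu) ^+ 2 =
     \sum_(x <- r) (w x * Y x ^+ 2 + (w x * Y x) * (- 2 * mu) + w x * mu ^+ 2).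
    by apply: eq_bigr => x _; ring.
  by rewrite !big_split /= -!mulr_suml w_sum1 mu_def; ring.
rewrite /Pr mulr_suml big_mkcond /=; apply: ler_sum => x _.
case: ifP => [/eqP ->|_]; first by rewrite sub0r sqrrN.
by rewrite mulr_ge0 ?sqr_ge0.
Qed.
End FiniteProbability.

Section SecondMoment.
Variables (R : realFieldType) (X : eqType) (r : seq X) (w : X -> R).
Hypotheses (w_ge0 : forall x, 0 <= w x) (w_sum1 : \sum_(x <- r) w x = 1).
Variables (n k m : nat) (EH : {set {set 'I_k}}) (G : X -> {set {set 'I_n}}).
Hypothesis EH_wf : graph_wf EH.
Variables (q : nat -> R) (rho : R).
Hypothesis Gq : forall F : {set {set 'I_n}}, F \subset Kedges n ->
  Pr r w (fun x => F \subset G x) = q #|F|.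
Hypotheses (m_gt0 : (0 < m)%N) (rho_gt0 : 0 < rho) (q_gt0 : 0 < q #|EH|).
(** Two copies sharing [c] edges are jointly present with at most [rho^-c] times the probability of
    two independent copies. For G(n,p) this is an equality with [rho = p]. *)
Hypothesis q_log : forall c, (c <= #|EH|)%N ->
  q (2 * #|EH| - c) * rho ^+ c <= q #|EH| ^+ 2.
Variable emb : 'I_k * 'I_m -> 'I_n.
Hypothesis emb_inj : injective emb.

Definition edges_in (S : {set 'I_k}) : nat := #|[set e in EH | e \subset S]|.

Variable L : R.
Hypothesis L_gt0 : 0 < L.
Hypothesis L_le : forall S, S != set0 -> L <= m%:R ^+ #|S| * rho ^+ edges_in S.

(** Each vertex of [H] is sent into a part of its own. Every [g] is then an embedding, and two
    copies can share a vertex only as the image of the same vertex of [H], so their overlap is read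
    off from the set where [g] and [g'] agree. *)
Definition part_map (g : {ffun 'I_k -> 'I_m}) : {ffun 'I_k -> 'I_n} :=
  [ffun x => emb (x, g x)].

Lemma part_map_inj g : injective (part_map g).
Proof. by move=> x y; rewrite !ffunE => /emb_inj[]. Qed.

Lemma edge_image_part_wf g : edge_image EH (part_map g) \subset Kedges n.
Proof.
apply/subsetP => _ /imsetP[e eH ->]; rewrite inE card_imset ?EH_wf //.
exact: part_map_inj.
Qed.

Lemma card_edge_image_part g : #|edge_image EH (part_map g)| = #|EH|.
Proof. by rewrite card_imset //; apply/imset_inj/part_map_inj. Qed.

Definition agree (g g' : {ffun 'I_k -> 'I_m}) := [set x | g x == g' x].

Lemma card_edge_image_common g g' :
  #|edge_image EH (part_map g) :&: edge_image EH (part_map g')| = edges_in (agree g g').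
Proof.
rewrite /edges_in -(card_imset _ (imset_inj (@part_map_inj g))); apply: eq_card => F.
rewrite inE; apply/andP/imsetP.
  case=> /imsetP[e eH ->] /imsetP[e' e'H ee'].
  have sub (h h' : {ffun 'I_k -> 'I_m}) (d d' : {set 'I_k}) :
      part_map h @: d = part_map h' @: d' -> d \subset d' /\ d \subset agree h h'.
    move=> /setP dd'; split; apply/subsetP => x xd; have := dd' (part_map h x);
      rewrite imset_f // => /esym/imsetP[y yd']; rewrite !ffunE => /emb_inj[exy gxy].
      by rewrite exy.
    by rewrite inE gxy exy.
  have [s1 s2] := sub _ _ _ _ ee'.
  by exists e => //; rewrite inE eH.
case=> e; rewrite inE => /andP[eH /subsetP s] ->; split; first exact: imset_f.
apply/imsetP; exists e => //; apply: eq_in_imset => x /s.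
by rewrite inE !ffunE => /eqP ->.
Qed.

Lemma edges_in_max S : (edges_in S <= #|EH|)%N.
Proof. by apply/subset_leq_card/subsetP => e; rewrite inE => /andP[]. Qed.

Lemma card_agree g (S : {set 'I_k}) :
  (#|[set g' | agree g g' == S]| * m ^ #|S| <= m ^ k)%N.
Proof.
pose F x : pred 'I_m := if x \in S then pred1 (g x) else predT.
have le1 : (#|[set g' | agree g g' == S]| <= #|family F|)%N.
  apply/subset_leq_card/subsetP => g'; rewrite inE => /eqP e; apply/familyP => x.
  rewrite /F; case: ifP => //; rewrite -e inE => /eqP ->; exact: eqxx.
apply: leq_trans (leq_mul le1 (leqnn _)) _.
rewrite card_family.
have -> : foldr muln 1%N [seq #|F x| | x : 'I_k] = (\prod_x #|F x|)%N.
  by rewrite foldrE big_image.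
have -> : (m ^ #|S| = \prod_(x : 'I_k) (if x \in S then m else 1))%N.
  by rewrite -big_mkcond prod_nat_const.
rewrite -big_split /= -[X in (_ <= m ^ X)%N]card_ord -prod_nat_const.
apply/eq_leq/eq_bigr => x _; rewrite /F; case: ifP => _; first by rewrite card1 mul1n.
by rewrite card_ord muln1.
Qed.

(** Expand the second moment over pairs and sort them by agreement set [S]. The empty set
    contributes at most the squared mean, which Chebyshev subtracts; each of the at most [2^k] other
    sets contributes at most the squared mean divided by [m^|S| rho^e(S)], which is at least [L]. *)
Lemma second_moment_parts :
  Pr r w (fun x => ~~ [exists g, embeds EH (G x) (part_map g)]) <= 2%:R ^+ k / L.
Proof.
pose I g x : R := (edge_image EH (part_map g) \subset G x)%:R.
pose Y x : R := \sum_g I g x.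
have sumI (B : pred X) : \sum_(x <- r) w x * (B x)%:R = Pr r w B.
  rewrite /Pr [RHS]big_mkcond; apply: eq_bigr => x _.
  by case: (B x); rewrite ?mulr1 ?mulr0.
pose M : R := m%:R ^+ k.
have M_gt0 : 0 < M by rewrite exprn_gt0 ?ltr0n.
have mu : \sum_(x <- r) w x * Y x = M * q #|EH|.
  under eq_bigr do rewrite mulr_sumr.
  rewrite exchange_big /= (eq_bigr (fun=> q #|EH|)) => [|g _].
    by rewrite sumr_const card_ffun !card_ord -mulr_natl natrX.
  by rewrite sumI Gq ?edge_image_part_wf // card_edge_image_part.
have le2 : \sum_(x <- r) w x * Y x ^+ 2 <= (M * q #|EH|) ^+ 2 * (1 + 2%:R ^+ k / L).
  have -> : \sum_(x <- r) w x * Y x ^+ 2 =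
      \sum_g \sum_g' q (2 * #|EH| - edges_in (agree g g')).
    under eq_bigr do rewrite expr2 /Y big_distrlr /= mulr_sumr.
    rewrite exchange_big; apply: eq_bigr => g _.
    under eq_bigr do rewrite mulr_sumr.
    rewrite exchange_big; apply: eq_bigr => g' _.
    transitivity (Pr r w (fun x =>
       edge_image EH (part_map g) :|: edge_image EH (part_map g') \subset G x)).
      rewrite -sumI; apply: eq_bigr => x _; rewrite /I subUset.
      by case: (_ \subset _); case: (_ \subset _); rewrite ?mulr1 ?mulr0 ?mul0r.
    rewrite Gq; last by rewrite subUset !edge_image_part_wf.
    by rewrite cardsU card_edge_image_common !card_edge_image_part mul2n addnn.
  pose c S : R := (rho ^+ edges_in S)^-1.
  have c_gt0 S : 0 < c S by rewrite invr_gt0 exprn_gt0.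
  have le_q g g' : q (2 * #|EH| - edges_in (agree g g')) <= q #|EH| ^+ 2 * c (agree g g').
    by rewrite ler_pdivlMr ?exprn_gt0 // q_log // edges_in_max.
  apply: le_trans (_ : q #|EH| ^+ 2 * \sum_g \sum_g' c (agree g g') <= _).
    rewrite mulr_sumr; apply: ler_sum => g _; rewrite mulr_sumr; exact: ler_sum.
  rewrite exprMn [M ^+ 2 * _]mulrC -[leRHS]mulrA ler_pM2l ?exprn_gt0 //.
  apply: le_trans (_ : \sum_(g : {ffun 'I_k -> 'I_m}) M * (1 + 2 ^+ k / L) <= _); last first.
    rewrite sumr_const card_ffun !card_ord. by rewrite -[leLHS]mulr_natl natrX -/M expr2 mulrA.
  apply: ler_sum => g _.
  rewrite (partition_big (agree g) predT) //=.
  have le_S S : \sum_(g' | agree g g' == S) c (agree g g') <= M * (m%:R ^+ #|S| * rho ^+ edges_in S)^-1.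
    rewrite (eq_bigr (fun=> c S)); last by move=> g' /eqP ->.
    rewrite sumr_const invfM mulrA -[leLHS]mulr_natl /c ler_pM2r ?invr_gt0 ?exprn_gt0 //.
    rewrite ler_pdivlMr ?exprn_gt0 ?ltr0n // /M -!natrX -natrM ler_nat.
    by have := card_agree g S; rewrite cardsE.
  apply: le_trans (ler_sum _ (fun S _ => le_S S)) _.
  rewrite -mulr_sumr ler_pM2l // (bigD1 set0) //= cards0 expr0 mul1r.
  have e0 : edges_in set0 = 0%N.
    apply: eq_card0 => e; rewrite !inE subset0; apply/negP => /andP[eH /eqP e0].
    by have := EH_wf eH; rewrite e0 cards0.
  rewrite e0 expr0 invr1 lerD2l.
  apply: le_trans (_ : \sum_(S : {set 'I_k} | S != set0) L^-1 <= _).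
    by apply: ler_sum => S S0; rewrite lef_pV2 ?L_le // posrE (lt_le_trans L_gt0) ?L_le.
  rewrite sumr_const -[leLHS]mulr_natl ler_pM2r ?invr_gt0 // -natrX ler_nat.
  by rewrite (leq_trans (max_card _)) // -cardsT -powersetT card_powerset cardsT card_ord.
have che := second_moment_zero w_ge0 w_sum1 mu.
have P_gt0 : 0 < (M * q #|EH|) ^+ 2 by rewrite exprn_gt0 ?mulr_gt0.
rewrite -(ler_pM2r P_gt0); apply: le_trans (_ : Pr r w (fun x => Y x == 0) * (M * q #|EH|) ^+ 2 <= _).
  rewrite ler_pM2r //; apply: Pr_mono => // x _ /existsPn noE.
  rewrite /Y big1 // => g _; rewrite /I; have := noE g.
  by rewrite /embeds (introT (injectiveP _) (@part_map_inj g)) /= => /negbTE ->.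
apply: le_trans che _; rewrite lerBlDr; apply: le_trans le2 _.
by rewrite mulrDr mulr1 addrC [in leRHS]mulrC.
Qed.

End SecondMoment.

(** * The binomial and the uniform random graph *)

Lemma binomial_superset_sum (R : realFieldType) (I : finType) (K F : {set I}) (p : R) :
  F \subset K ->
  \sum_(E <- enum (powerset K) | F \subset E) p ^+ #|E| * (1 - p) ^+ (#|K| - #|E|) =
  p ^+ #|F|.
Proof.
move=> sFK; rewrite big_enum_cond /=.
(* Multiply out [f i + g i] over all [i], with [f] for present and [g] for absent: [g] vanishes on
   [F], which forces presence, and [f] vanishes off [K], which forces absence. *)
pose f i : R := if i \in K then p else 0.
pose g i : R := if i \in K then if i \in F then 0 else 1 - p else 1.
have <- : \prod_i (f i + g i) = p ^+ #|F|.
  rewrite -prodr_const [RHS]big_mkcond; apply: eq_bigr => i _; rewrite /f /g.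
  case: ifP => iK; case: ifP => iF; rewrite ?addr0 ?add0r //.
    by rewrite addrC subrK.
  by rewrite (subsetP sFK) in iK.
rewrite bigA_distr big_mkcond /=; apply: eq_bigr => J _; rewrite powersetE.
case: ifP => [/andP[sJK sFJ]|nJ]; last first.
  move/negbT: nJ; rewrite negb_and => /orP[] /subsetPn[i i1 i2]; rewrite (bigD1 i) //=.
    by rewrite i1 /f (negbTE i2) mul0r.
  by rewrite (negbTE i2) /g i1 (subsetP sFK) // mul0r.
rewrite (bigID (mem J)) /=; congr (_ * _).
  rewrite -prodr_const; apply: eq_bigr => i iJ.
  by rewrite iJ /f (subsetP sJK).
rewrite (bigID (mem K)) /= [X in _ * X]big1 ?mulr1; last first.
  by move=> i /andP[iJ iK]; rewrite (negbTE iJ) /g (negbTE iK).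
have -> : (#|K| - #|J| = #|K :\: J|)%N by rewrite cardsD (setIidPr sJK).
rewrite -prodr_const; apply: eq_big => [i|i]; first by rewrite inE.
rewrite inE => /andP[iJ iK]; rewrite (negbTE iJ) /g iK; case: ifP => // iF.
by rewrite (subsetP sFJ) in iJ.
Qed.

Section Falling.
Variables (R : realFieldType) (f : nat -> R).
Hypothesis f_ge0 : forall i, 0 <= f i.
Hypothesis f_noninc : forall i j, (i <= j)%N -> f j <= f i.

(** For [f i = (M - i) / (T - i)] this is the probability that [j] given edges are among the first
    [M] of [T] in a random ordering. *)
Definition prefix_prod j := \prod_(i < j) f i.

Lemma prefix_prod_ge0 j : 0 <= prefix_prod j.
Proof. exact: prodr_ge0. Qed.

Lemma prefix_prodD i j : prefix_prod (i + j) = prefix_prod i * \prod_(l < j) f (i + l).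
Proof. by rewrite /prefix_prod big_split_ord. Qed.

Lemma prefix_prod_le j : prefix_prod j <= f 0%N ^+ j.
Proof.
rewrite -[X in _ ^+ X]card_ord -prodr_const; apply: ler_prod => i _.
by rewrite f_ge0 f_noninc.
Qed.

(** Write [2e - c] as [e + (e - c)]. By monotonicity the [e - c] late factors are at most the first
    [e - c], and the [c] factors then missing from the second product are each at least [rho]. This
    provides [q_log] for the process. *)
Lemma prefix_prod_log e c rho : 0 <= rho -> (forall i, (i < e)%N -> rho <= f i) ->
  (c <= e)%N -> prefix_prod (2 * e - c) * rho ^+ c <= prefix_prod e ^+ 2.
Proof.
move=> rho_ge0 rho_le le_ce.
have -> : (2 * e - c = e + (e - c))%N by lia.
rewrite prefix_prodD expr2 -mulrA ler_wpM2l ?prefix_prod_ge0 //.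
have -> : prefix_prod e = prefix_prod (e - c + c) by rewrite subnK.
rewrite prefix_prodD; apply: ler_pM.
- exact: prodr_ge0.
- exact: exprn_ge0.
- by apply: ler_prod => i _; rewrite f_ge0 f_noninc //; lia.
rewrite -[X in _ ^+ X]card_ord -prodr_const; apply: ler_prod => i _.
by rewrite rho_ge0 rho_le //; have := ltn_ord i; lia.
Qed.
End Falling.

Section Ratio.
Variables (R : realFieldType) (M T : nat).
(** Truncated subtraction makes the ratio zero from [i = M] on, as it should be: more than [M] edges
    cannot all have been drawn. *)
Definition draw_ratio i : R := (M - i)%:R / (T - i)%:R.

Lemma draw_ratio_ge0 i : 0 <= draw_ratio i.
Proof. by rewrite divr_ge0. Qed.

Lemma draw_ratio_noninc i j : (M <= T)%N -> (i <= j)%N -> draw_ratio j <= draw_ratio i.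
Proof.
move=> MT ij; have [Mj|jM] := leqP M j.
  by rewrite /draw_ratio (eqP Mj) mul0r draw_ratio_ge0.
rewrite /draw_ratio ler_pdivrMr ?ltr0n; last lia.
rewrite mulrAC ler_pdivlMr ?ltr0n; last lia.
by rewrite -!natrM ler_nat; nia.
Qed.
End Ratio.

Section UniformOrdering.
Variables (I : finType) (l : seq I) (M : nat).
Hypotheses (l_uniq : uniq l) (M_le : (M <= size l)%N).
Local Open Scope nat_scope.

Definition count_above (F : {set I}) :=
  count (fun s => F \subset [set e in take M s]) (permutations l).

Lemma count_permutations_map (t : I -> I) (P : pred (seq I)) :
  injective t -> perm_eq (map t l) l ->
  count (fun s => P (map t s)) (permutations l) = count P (permutations l).
Proof.
move=> tI tl; rewrite -[LHS](count_map (map t) P).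
suff /seq.permP -> : perm_eq (map (map t) (permutations l)) (permutations l) by [].
have inj_mt : injective (map t) by apply: inj_map.
have sub : {subset map (map t) (permutations l) <= permutations l}.
  move=> _ /mapP[s sl ->]; rewrite mem_permutations in sl *.
  by rewrite mem_permutations (perm_trans (perm_map t sl) tl).
have u : uniq (map (map t) (permutations l)) by rewrite map_inj_uniq ?permutations_uniq.
apply: uniq_perm => //; first exact: permutations_uniq.
by apply: (uniq_min_size u sub _).2; rewrite size_map.
Qed.

(* Swapping [x] and [y] in every ordering exchanges the two events. *)
Lemma count_above_swap (F : {set I}) x y :
  x \in l -> y \in l -> x \notin F -> y \notin F ->
  count_above (x |: F) = count_above (y |: F).
Proof.
move=> xl yl xF yF; pose t := tperm x y.
rewrite /count_above -(@count_permutations_map t (fun s => y |: F \subset _)); first last.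
- apply: uniq_perm => //; first by rewrite map_inj_uniq //; apply: perm_inj.
  move=> z; apply/mapP/idP => [[u ul ->]|zl].
    by rewrite /t; case: tpermP.
  exists (t z); last by rewrite /t tpermK.
  by rewrite /t; case: tpermP.
- exact: perm_inj.
apply: eq_count => s; rewrite -map_take.
have mem_t z : (t z \in [set e in map t (take M s)]) = (z \in take M s).
  by rewrite inE mem_map //; apply: perm_inj.
rewrite !subUset !sub1set -{1}(tpermL x y) -/t mem_t inE; congr (_ && _).
have mem_F z : z \in F -> (z \in [set e in map t (take M s)]) = (z \in [set e in take M s]).
  move=> zF; rewrite [RHS]inE -mem_t /t tpermD //; first by apply: contraNneq xF => ->.
  by apply: contraNneq yF => ->.
by apply/subsetP/subsetP => h z zF; have := h z zF; rewrite mem_F.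
Qed.

(** Double count pairs of an ordering and a [y] outside [F] with [y |: F] among the first [M]
    entries. By symmetry every [y] has equally many orderings, and an ordering whose first [M]
    entries contain [F] has [M - #|F|] such [y]. *)
Lemma count_above_step (F : {set I}) x : F \subset [set e in l] -> x \in l -> x \notin F ->
  count_above (x |: F) * (size l - #|F|) = count_above F * (M - #|F|).
Proof.
move=> sFl xl xF; pose D := [set e in l] :\: F.
have cD : #|D| = size l - #|F|.
  rewrite cardsD (setIidPr sFl); congr (_ - _).
  by rewrite cardsE; apply/card_uniqP.
transitivity (\sum_(y in D) count_above (y |: F)).
  rewrite -cD mulnC -sum_nat_const; apply: eq_bigr => y; rewrite !inE => /andP[yF yl].
  exact: count_above_swap.
transitivity (\sum_(s <- permutations l) \sum_(y in D) (y |: F \subset [set e in take M s])).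
  rewrite exchange_big; apply: eq_bigr => y _.
  by rewrite /count_above -sum1_count big_mkcond; apply: eq_bigr => s _; case: ifP.
rewrite /count_above -sum1_count big_distrl /= [RHS]big_mkcond /= big_seq [RHS]big_seq.
apply: eq_bigr => s; rewrite mem_permutations => sl.
have us : uniq s by rewrite (perm_uniq sl).
have cM : #|[set e in take M s]| = M.
  rewrite cardsE (card_uniqP (take_uniq M us)) size_takel //.
  by rewrite (perm_size sl).
case: ifP => [sF|nF].
  have -> : M - #|F| = #|[set e in take M s] :\: F| by rewrite cardsD (setIidPr sF) cM.
  rewrite mul1n -sum1_card big_mkcond [RHS]big_mkcond.
  apply: eq_bigr => y _; rewrite !inE subUset sub1set sF andbT inE.
  case: (y \in F) => //=; case: (boolP (y \in take M s)) => [ys|_]; last by case: ifP.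
  by rewrite -(perm_mem sl) (mem_take ys).
by rewrite big1 // => y _; rewrite subUset nF andbF.
Qed.

Lemma ordering_superset_prob (R : realFieldType) (F : {set I}) : F \subset [set e in l] ->
  Pr (permutations l) (fun=> (size (permutations l))%:R^-1)
    (fun s => F \subset [set e in take M s])
  = prefix_prod (draw_ratio R M (size l)) #|F|.
Proof.
set c : R := _^-1 => sF.
have PrE (F' : {set I}) : Pr (permutations l) (fun=> c) (fun s => F' \subset [set e in take M s])
    = ((count_above F')%:R * c)%R.
  by rewrite /Pr big_const_seq iter_addr_0 -[LHS]mulr_natl.
rewrite PrE; elim: {F}_.+1 {-2}F (ltnSn #|F|) sF => // m IH F ltF sF.
case: (set_0Vmem F) => [->|[x xF]].
  rewrite cards0 /prefix_prod big_ord0 /count_above.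
  rewrite (eq_count (a2 := predT)) => [|s]; last by rewrite sub0set.
  rewrite count_predT mulfV // pnatr_eq0 -lt0n.
  by have := mem_permutations l l; rewrite perm_refl; case: permutations.
have xl : x \in l by have := subsetP sF _ xF; rewrite inE.
have xF' : x \notin F :\ x by rewrite !inE eqxx.
have sF' : F :\ x \subset [set e in l] by apply: subset_trans (subsetDl _ _) sF.
have cF := cardsD1 x F; rewrite xF /= add1n in cF.
have /(congr1 (fun z : nat => (z%:R : R)%R)) := count_above_step sF' xl xF'.
rewrite setD1K // !natrM => step.
have lt : #|F :\ x| < size l.
  have : #|F| <= #|[set e in l]| by apply: subset_leq_card.
  by rewrite cardsE cF (card_uniqP l_uniq).
have nz : ((size l - #|F :\ x|)%:R != 0 :> R)%R by rewrite pnatr_eq0; lia.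
rewrite cF /prefix_prod big_ord_recr /= -/(prefix_prod _ _) -IH //; last by rewrite -ltnS -cF.
rewrite /draw_ratio mulrA; apply: (mulIf nz); rewrite mulfVK // [LHS]mulrAC step.
by rewrite [in RHS]mulrAC.
Qed.

End UniformOrdering.

(** * First moment *)

Section FirstMoment.
Variables (R : realFieldType) (X : eqType) (r : seq X) (w : X -> R).
Hypotheses (w_ge0 : forall x, 0 <= w x) .
Variables (n k : nat) (EH : {set {set 'I_k}}) (G : X -> {set {set 'I_n}}) (p : R).
Hypothesis EH_wf : graph_wf EH.
Hypotheses (p_ge0 : 0 <= p) (Gp : forall F : {set {set 'I_n}}, F \subset Kedges n ->
  Pr r w (fun x => F \subset G x) <= p ^+ #|F|).

Lemma edge_image_wf (J : {set {set 'I_k}}) (f : {ffun 'I_k -> 'I_n}) :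
  J \subset EH -> injectiveb f -> edge_image J f \subset Kedges n.
Proof.
move=> /subsetP sJ /injectiveP fI; apply/subsetP => _ /imsetP[e eJ ->].
by rewrite inE card_imset // EH_wf ?sJ.
Qed.

Lemma card_edge_image (J : {set {set 'I_k}}) (f : {ffun 'I_k -> 'I_n}) :
  injectiveb f -> #|edge_image J f| = #|J|.
Proof. by move=> /injectiveP fI; rewrite card_imset //; apply: imset_inj. Qed.

Lemma card_family_pred (S : {set 'I_k}) (P Q : 'I_k -> pred 'I_n) c d :
  (forall x, #|P x| <= c)%N -> (forall x, #|Q x| <= d)%N ->
  (#|family (fun x => if x \in S then P x else Q x)| <= c ^ #|S| * d ^ (k - #|S|))%N.
Proof.
move=> Pc Qd; rewrite card_family foldrE big_image /= (bigID (mem S)) /=; apply: leq_mul.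
  rewrite -prod_nat_const; apply: leq_prod => x xS; by rewrite xS.
have -> : (k - #|S| = #|~: S|)%N by have := cardsC S; rewrite card_ord; lia.
rewrite -prod_nat_const [leqRHS](eq_bigl (fun x => x \notin S)) => [|x]; last by rewrite inE.
by apply: leq_prod => x xS; rewrite (negbTE xS).
Qed.

(** A copy of [H] contains a copy of each of its subgraphs, so it is enough to count placements of
    [S]. *)
Lemma first_moment_subgraph (SF : {set 'I_k} * {set {set 'I_k}}) : is_subgraph EH SF ->
  Pr r w (fun x => contains_copy EH (G x) setT) <= n%:R ^+ #|SF.1| * p ^+ #|SF.2|.
Proof.
case: SF => S F /and3P[/= S0 sF /forall_inP FS].
have [n0|n_gt0] := posnP n.
  rewrite (_ : Pr _ _ _ = 0) ?mulr_ge0 ?exprn_ge0 //; rewrite /Pr big1 // => x.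
  case/contains_copyP => f _ _; case/set0Pn: S0 => y _.
  by have := ltn_ord (f y); lia.
pose v0 := Ordinal n_gt0.
(* A partial map on [S] is encoded as a total one with the dummy value [v0] elsewhere, so that there
   are at most [n^|S|] of them. *)
pose restr (f : {ffun 'I_k -> 'I_n}) : {ffun 'I_k -> 'I_n} :=
  [ffun x => if x \in S then f x else v0].
pose P := [set restr f | f : {ffun 'I_k -> 'I_n} & injectiveb f].
have restrE f : edge_image F (restr f) = edge_image F f.
  apply: eq_in_imset => e eF; apply: eq_in_imset => x xe.
  by rewrite ffunE (subsetP (FS _ eF)).
apply: le_trans (_ : Pr r w (fun x => [exists f in P, edge_image F f \subset G x]) <= _).
  apply: Pr_mono => // x _ /contains_copyP[f /andP[fI fE] _].
  apply/existsP; exists (restr f); rewrite restrE imset_f ?inE //=.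
  by apply: subset_trans fE; apply: imsetS.
apply: le_trans (Pr_union _ w_ge0 (mem P) (fun f x => edge_image F f \subset G x)) _.
apply: le_trans (_ : \sum_(f in P) p ^+ #|F| <= _).
  apply: ler_sum => g /imsetP[f]; rewrite inE => fI ->; rewrite restrE.
  by apply: le_trans (Gp (edge_image_wf sF fI)) _; rewrite card_edge_image.
rewrite sumr_const -[leLHS]mulr_natl ler_wpM2r ?exprn_ge0 // -natrX ler_nat.
have sP : P \subset family (fun x => if x \in S then predT else pred1 v0).
  apply/subsetP => _ /imsetP[f _ ->]; apply/familyP => x; rewrite ffunE.
  by case: ifP => // _; rewrite inE.
apply: leq_trans (subset_leq_card sP) _; rewrite card_family foldrE big_image /=.
rewrite -prod_nat_const [leqRHS]big_mkcond; apply: leq_prod => x _.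
by case: ifP; rewrite ?card1 ?card_ord.
Qed.

Definition clash (fg : {ffun 'I_k -> 'I_n} * {ffun 'I_k -> 'I_n}) : bool :=
  [&& injectiveb fg.1, injectiveb fg.2, [exists x, fg.2 x \in fg.1 @: setT]
    & (fg.1 @: setT, edge_image EH fg.1) != (fg.2 @: setT, edge_image EH fg.2)].

Definition has_clash (E : {set {set 'I_n}}) : bool :=
  [exists fg in clash, edge_image EH fg.1 :|: edge_image EH fg.2 \subset E].

Lemma no_clash_disjoint E : ~~ has_clash E -> copies_disjoint EH E.
Proof.
move=> /existsPn nc f g /andP[fI fE] /andP[gI gE] x y fxy; apply/eqP.
move: (nc (f, g)); rewrite negb_and subUset fE gE orbF /= unfold_in /clash /= fI gI /=.
case/nandP => [/existsPn nx|/negPn //]; have := nx y.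
by rewrite -fxy imset_f.
Qed.

(** The intersection of the two copies, pulled back along the second embedding so that it becomes a
    subgraph of [H] itself. *)
Definition overlap (fg : {ffun 'I_k -> 'I_n} * {ffun 'I_k -> 'I_n}) :=
  ([set x | fg.2 x \in fg.1 @: setT],
   [set e in EH | fg.2 @: (e : {set 'I_k}) \in edge_image EH fg.1]).

(** If the overlap were all of [H], the second copy would lie inside the first and equal it by
    cardinality. *)
Lemma overlap_subgraph fg : clash fg ->
  is_subgraph EH (overlap fg) && (overlap fg != (setT, EH)).
Proof.
case: fg => f g /and4P[/= fI gI /existsP[x gx] neq]; apply/andP; split.
  apply/and3P; split; rewrite /overlap /=.
  - by apply/set0Pn; exists x; rewrite inE.
  - by apply/subsetP => e; rewrite inE => /andP[].
  apply/forall_inP => e; rewrite inE => /andP[eH /imsetP[d dH ged]].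
  apply/subsetP => y ye; rewrite inE.
  have : g y \in f @: d by rewrite -ged imset_f.
  by case/imsetP => z _ ->; rewrite imset_f.
apply: contraNneq neq => -[/setP ST /setP FE]; rewrite xpair_eqE.
have cI (h : {ffun 'I_k -> 'I_n}) : injectiveb h -> #|h @: setT| = k.
  by move=> /injectiveP hI; rewrite card_imset // cardsT card_ord.
apply/andP; split; rewrite eq_sym eqEcard.
  rewrite !cI // leqnn andbT; apply/subsetP => _ /imsetP[y _ ->].
  by have := ST y; rewrite !inE.
rewrite !card_edge_image // leqnn andbT; apply/subsetP => _ /imsetP[e eH ->].
by have := FE e; rewrite inE eH.
Qed.

Lemma card_clash_union fg : clash fg ->
  #|edge_image EH fg.1 :|: edge_image EH fg.2| = (2 * #|EH| - #|(overlap fg).2|)%N.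
Proof.
case: fg => f g /and4P[/= fI gI _ _]; rewrite cardsU !card_edge_image // mul2n addnn.
congr (_ - _)%N; rewrite -(card_edge_image _ gI); apply: eq_card => F; rewrite inE.
apply/andP/imsetP => [[Ff /imsetP[e eH Fe]]|[e]].
  by exists e; rewrite // inE eH -Fe.
by rewrite inE => /andP[eH ?] ->; split=> //; apply: imset_f.
Qed.

(** The first map has at most [n^k] choices. The second must send [SF.1] into the [k] image points
    of the first, at most [k^k] ways, and is free elsewhere. *)
Lemma card_overlap SF : (0 < k)%N ->
  (#|[set fg | clash fg && (overlap fg == SF)]| <= k ^ k * n ^ (2 * k - #|SF.1|))%N.
Proof.
move=> k_gt0; have Sk : (#|SF.1| <= k)%N by rewrite (leq_trans (max_card _)) ?card_ord.
set D := [set fg | _].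
have -> : #|D| = (\sum_(f : {ffun 'I_k -> 'I_n}) #|[set g | (f, g) \in D]|)%N.
  rewrite -sum1_card (partition_big (fun fg : _ * _ => fg.1) predT) //=.
  apply: eq_bigr => f _; rewrite -sum1_card.
  rewrite (reindex_onto (fun g => (f, g)) (fun fg => fg.2)) /=; last first.
    by move=> [f' g'] /= /andP[_ /eqP ->].
  by apply: eq_bigl => g; rewrite [RHS]inE !eqxx !andbT.
apply: leq_trans (_ : \sum_(f : {ffun 'I_k -> 'I_n}) k ^ k * n ^ (k - #|SF.1|) <= _)%N.
  apply: leq_sum => f _.
  apply: leq_trans (_ : #|family (fun x => if x \in SF.1 then mem (f @: setT) : pred _ else predT)| <= _)%N.
    apply/subset_leq_card/subsetP => g; rewrite !inE => /andP[_ /eqP <-].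
    by apply/familyP => x; rewrite inE; case: ifP.
  apply: leq_trans (card_family_pred (c := k) (d := n) SF.1 _ _) _.
  - by move=> x; rewrite (leq_trans (leq_imset_card _ _)) // cardsT card_ord.
  - by move=> x; rewrite card_ord.
  by rewrite leq_mul // leq_pexp2l.
rewrite sum_nat_const card_ffun !card_ord mulnCA -expnD.
by rewrite leq_mul // (_ : k + (k - #|SF.1|) = 2 * k - #|SF.1|)%N //; lia.
Qed.

Lemma first_moment_clash : (0 < k)%N ->
  Pr r w (fun x => has_clash (G x)) <=
  \sum_(SF | is_subgraph EH SF && (SF != (setT, EH)))
    (k ^ k)%:R * n%:R ^+ (2 * k - #|SF.1|) * p ^+ (2 * #|EH| - #|SF.2|).
Proof.
move=> k_gt0.
apply: le_trans (Pr_union _ w_ge0 clash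
  (fun fg x => edge_image EH fg.1 :|: edge_image EH fg.2 \subset G x)) _.
apply: le_trans (_ : \sum_(fg in clash) p ^+ (2 * #|EH| - #|(overlap fg).2|) <= _).
  apply: ler_sum => fg cfg; rewrite -card_clash_union //; apply: Gp.
  by case/and4P: cfg => fI gI _ _; rewrite subUset !edge_image_wf.
rewrite (partition_big overlap (fun SF => is_subgraph EH SF && (SF != (setT, EH))));
  last exact: overlap_subgraph.
apply: ler_sum => SF _.
rewrite (eq_bigr (fun=> p ^+ (2 * #|EH| - #|SF.2|))); last by move=> fg /andP[_ /eqP ->].
rewrite sumr_const -[leLHS]mulr_natl ler_wpM2r ?exprn_ge0 // -natrX -natrM ler_nat.
by have := card_overlap SF k_gt0; rewrite cardsE.
Qed.

End FirstMoment.

(** * Asymptotics *)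

Definition eventually (P : nat -> Prop) := exists n0, forall n, (n0 <= n)%N -> P n.

Lemma ev_ge m : eventually (fun n => m <= n)%N.
Proof. by exists m. Qed.

Lemma ev_mono (P Q : nat -> Prop) : (forall n, P n -> Q n) -> eventually P -> eventually Q.
Proof. by move=> PQ [n0 H]; exists n0 => n /H /PQ. Qed.

Lemma ev_and (P Q : nat -> Prop) :
  eventually P -> eventually Q -> eventually (fun n => P n /\ Q n).
Proof.
move=> [n1 H1] [n2 H2]; exists (maxn n1 n2) => n; rewrite geq_max => /andP[? ?].
by split; [apply: H1 | apply: H2].
Qed.

Lemma ev_all (I : finType) (P : I -> nat -> Prop) :
  (forall i, eventually (P i)) -> eventually (fun n => forall i, P i n).
Proof.
move=> /fin_all_exists[n0 H]; exists (\max_i n0 i) => n le_n i.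
by apply: H; apply: leq_trans le_n; apply: leq_bigmax.
Qed.

Lemma ev_sum_small (I : finType) (P : pred I) (F : I -> nat -> R) (eps : R) : 0 < eps ->
  (forall i, P i -> forall d : R, 0 < d -> eventually (fun n => F i n <= d)) ->
  eventually (fun n => \sum_(i | P i) F i n <= eps).
Proof.
move=> eps0 FP; pose d := eps / #|I|.+1%:R.
have d0 : 0 < d by rewrite divr_gt0.
apply: (ev_mono (P := fun n => forall i, P i -> F i n <= d)).
  move=> n Fd; apply: le_trans (ler_sum _ Fd) _.
  rewrite sumr_const -[leLHS]mulr_natl /d mulrCA -[leRHS]mulr1 ler_pM2l //.
  by rewrite ler_pdivrMr ?ltr0n // mul1r ler_nat (leq_trans (max_card _)).
apply: ev_all => i; case: (boolP (P i)) => [Pi|_]; last by exists 0%N.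
by apply: ev_mono (FP i Pi d d0).
Qed.

Section NRoot.
Variable D : R.
Hypothesis D_gt0 : 0 < D.

(** With [D] the maximum density, this is the reciprocal of the threshold probability. *)
Definition nroot (n : nat) : R := Rpower (INR n) (Rinv D).

Lemma nroot_gt0 n : 0 < nroot n.
Proof. by apply/RltP; apply: exp_pos. Qed.

Lemma nroot_exp n j : nroot n ^+ j = Rpower (INR n) (j%:R / D)%R.
Proof.
rewrite -RpowE -Rpower_pow; last by apply/RltP; apply: nroot_gt0.
by rewrite /nroot Rpower_mult (INRE j) RmultE RinvE mulrC.
Qed.

Lemma natr_exp n s : (0 < n)%N -> (n%:R : R) ^+ s = Rpower (INR n) s%:R.
Proof.
move=> n0; rewrite -INRE -RpowE -Rpower_pow -?INRE //.
by apply/RltP; rewrite INRE ltr0n.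
Qed.

Lemma nroot_exp_le n j s : (0 < n)%N -> j%:R <= D * s%:R -> nroot n ^+ j <= n%:R ^+ s.
Proof.
move=> n0 js; rewrite nroot_exp natr_exp //; apply/RleP/Rle_Rpower.
  by apply/RleP; rewrite INRE ler1n.
by apply/RleP; rewrite ler_pdivrMr // mulrC.
Qed.

Lemma nroot_exp_eq n e k : (0 < n)%N -> e%:R = D * k%:R -> nroot n ^+ e = n%:R ^+ k.
Proof.
move=> n0 ek; rewrite nroot_exp natr_exp // ek; congr Rpower; rewrite mulrAC mulfV ?mul1r //.
by rewrite gt_eqF.
Qed.

Lemma Rpower_large (d B : R) : 0 < d -> eventually (fun n => B <= Rpower (INR n) d).
Proof.
move=> d0; have [n0 Hn0] := INR_unbounded (Rpower (Num.max 1 B) (Rinv d)).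
exists n0.+1 => n ltn.
have B0 : (0 < Num.max 1 B)%R by rewrite lt_max ltr01.
apply: le_trans (_ : Num.max 1 B <= _); first by rewrite le_max lexx orbT.
apply/RleP; rewrite -[X in Rle X _]Rpower_1; last exact/RltP.
have <- : Rmult (Rinv d) d = IZR 1 by rewrite Rinv_l //; apply/eqP; rewrite gt_eqF.
rewrite -Rpower_mult; apply: Rle_Rpower_l; first exact/RleP/ltW.
split; first exact: exp_pos.
apply: Rlt_le; apply: Rlt_le_trans Hn0 _; apply: le_INR; lia.
Qed.

Lemma nroot_large (B : R) : eventually (fun n => B <= nroot n).
Proof. by apply: Rpower_large; rewrite RinvE invr_gt0. Qed.

Lemma nroot_exp_small j s (d : R) : 0 < d -> j%:R < D * s%:R ->
  eventually (fun n => nroot n ^+ j <= d * n%:R ^+ s).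
Proof.
move=> d0 js; have gap : 0 < s%:R - j%:R / D by rewrite subr_gt0 ltr_pdivrMr // mulrC.
apply: ev_mono (ev_and (ev_ge 1) (Rpower_large d^-1 gap)) => n [n0 le].
rewrite nroot_exp natr_exp // -ler_pdivrMl // .
apply: le_trans (ler_wpM2r _ le) _; first by apply/RleP/Rlt_le/exp_pos.
by rewrite -[X in X <= _]/(Rmult _ _) -Rpower_plus RplusE subrK.
Qed.

End NRoot.

Section PartDensity.
Variables (D : R) (k N : nat) (EH : {set {set 'I_k}}).
Hypotheses (D_gt0 : 0 < D) (k_gt0 : (0 < k)%N) (N_gt0 : (0 < N)%N).
Hypothesis EH_D : forall S : {set 'I_k}, S != set0 -> (edges_in EH S)%:R <= D * #|S|%:R.

(** Parts have size at least [n / c] with [c = 2Nk], the 2 absorbing the rounding. As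
    [e(S) <= D |S|], the powers of [n] leave at least [C^e(S) / c^|S|], and [C = 1 + L c^k] makes
    this at least [L] once [e(S) > 0]. Without edges, the part size itself exceeds [L] for large
    [n]. *)
Lemma part_density (L : R) : 0 < L -> exists2 C : R, 0 < C & eventually (fun n =>
  (0 < n %/ (N * k))%N /\ forall rho, C / nroot D n <= rho ->
  forall S : {set 'I_k}, S != set0 ->
    L <= (n %/ (N * k))%:R ^+ #|S| * rho ^+ edges_in EH S).
Proof.
move=> L0; pose c : R := (2 * (N * k))%:R.
have c1 : 1 <= c by rewrite ler1n; nia.
have c0 : 0 < c by apply: lt_le_trans c1.
pose C := 1 + L * c ^+ k.
have C1 : 1 <= C by rewrite lerDl mulr_ge0 ?exprn_ge0 // ltW.
exists C; first by apply: lt_le_trans C1.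
have [n1 Hn1] : eventually (fun n => L * c <= n%:R).
  have [n1 Hn1] := INR_unbounded (L * c); exists n1 => n le_n.
  move/RltP: Hn1; rewrite INRE => /ltW /le_trans; apply; by rewrite ler_nat.
exists (maxn n1 (N * k)) => n; rewrite geq_max => /andP[/Hn1 le1 le2].
have Nk : (0 < N * k)%N by rewrite muln_gt0 N_gt0.
set m := (n %/ (N * k))%N.
have m0 : (0 < m)%N by rewrite divn_gt0.
split=> // rho le_rho S S0.
have n0 : (0 < n)%N by lia.
have le_m : n%:R / c <= m%:R.
  rewrite ler_pdivrMr // -natrM ler_nat.
  have := ltn_ceil n Nk; rewrite -/m => lt; nia.
have s0 : (0 < #|S|)%N by rewrite card_gt0.
have [e0|e0] := posnP (edges_in EH S).
  rewrite e0 expr0 mulr1; apply: le_trans (_ : m%:R <= _).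
    by apply: le_trans le_m; rewrite ler_pdivlMr.
  by rewrite -natrX ler_nat -{1}(expn1 m) leq_pexp2l.
have x0 := nroot_gt0 D n; set x := nroot D n in x0 le_rho.
apply: le_trans (_ : (n%:R / c) ^+ #|S| * (C / x) ^+ edges_in EH S <= _); last first.
  have nc0 : 0 <= n%:R / c by rewrite divr_ge0 // ltW.
  have Cx0 : 0 <= C / x by rewrite divr_ge0 // ltW // (lt_le_trans _ C1).
  apply: ler_pM; [exact: exprn_ge0 | exact: exprn_ge0 | |].
    by apply: lerXn2r; rewrite ?nnegrE.
  by apply: lerXn2r; rewrite ?nnegrE // (le_trans Cx0).
have le_x := nroot_exp_le D_gt0 n0 (EH_D S0); rewrite -/x in le_x.
have xe : 0 < x ^+ edges_in EH S by rewrite exprn_gt0.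
have cs : 0 < c ^+ #|S| by rewrite exprn_gt0.
rewrite !expr_div_n mulrACA -invfM ler_pdivlMr ?mulr_gt0 //.
rewrite mulrA [leRHS]mulrC; apply: ler_pM => //.
- by rewrite mulr_ge0 // ltW.
- exact: ltW.
apply: le_trans (_ : C <= _); last by rewrite -[leLHS]expr1 ler_weXn2l.
apply: le_trans (_ : L * c ^+ k <= _); last by rewrite lerDr.
rewrite ler_pM2l // ler_weXn2l // (leq_trans (max_card _)) ?card_ord //.
Qed.

Hypothesis EH_wf : graph_wf EH.

Definition has_blocks (n : nat) (E : {set {set 'I_n}}) : bool :=
  [exists f : {ffun 'I_N * 'I_k -> 'I_n},
    injectiveb f && [forall j, embeds EH E (block_map f j)]].

(** The vertices are cut into [N] groups of [k] parts each. In one group the second moment fails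
    with probability at most [2^k / L = eps / N]; a union bound finishes, and copies from different
    groups are disjoint. The constant [C] is chosen before the probability space, so it serves both
    random graph models. *)
Lemma whp_has_blocks (eps : R) : 0 < eps -> exists2 C : R, 0 < C & eventually (fun n =>
  forall (X : eqType) (r : seq X) (w : X -> R) (G : X -> {set {set 'I_n}}) (q : nat -> R) rho,
    (forall x, 0 <= w x) -> \sum_(x <- r) w x = 1 ->
    (forall F : {set {set 'I_n}}, F \subset Kedges n ->
       Pr r w (fun x => F \subset G x) = q #|F|) ->
    0 < q #|EH| ->
    (forall c, (c <= #|EH|)%N -> q (2 * #|EH| - c)%N * rho ^+ c <= q #|EH| ^+ 2) ->
    C / nroot D n <= rho ->
    Pr r w (fun x => ~~ has_blocks (G x)) <= eps).
Proof.
move=> eps0; pose L : R := N%:R * 2%:R ^+ k / eps.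
have L0 : 0 < L by rewrite divr_gt0 // mulr_gt0 ?exprn_gt0 ?ltr0n.
have [C C0 HC] := part_density L0; exists C => //.
apply: ev_mono HC => n [m0 Hn] X r w G q rho w0 w1 Gq q0 qlog le_rho.
set m := (n %/ (N * k))%N in m0 Hn.
have rho0 : 0 < rho by apply: lt_le_trans le_rho; rewrite divr_gt0 ?nroot_gt0.
have le_card : (#|{: 'I_N * ('I_k * 'I_m)}| <= n)%N.
  by rewrite !card_prod !card_ord mulnA mulnC leq_divM.
pose phi (t : 'I_N * ('I_k * 'I_m)) : 'I_n := widen_ord le_card (enum_rank t).
have phiI : injective phi by move=> s t /(congr1 val) /= /val_inj/enum_rank_inj.
pose emb i (xu : 'I_k * 'I_m) := phi (i, xu).
have embI i : injective (emb i) by move=> s t /phiI[].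
have sm i := second_moment_parts w0 w1 EH_wf Gq m0 rho0 q0 qlog (@embI i) L0 (Hn rho le_rho).
apply: le_trans (_ : Pr r w (fun x => [exists i in predT,
    ~~ [exists g, embeds EH (G x) (part_map (emb i) g)]]) <= _).
  apply: Pr_mono => // x _; apply: contraNT.
  move=> /existsPn all_i.
  have /fin_all_exists[g gP] i : exists g, embeds EH (G x) (part_map (emb i) g).
    by have := all_i i; rewrite negb_and /= negbK => /existsP.
  apply/existsP; exists [ffun jx => emb jx.1 (jx.2, g jx.1 jx.2)]; apply/andP; split.
    apply/injectiveP => -[i y] [j z]; rewrite !ffunE /= => /phiI[-> -> _] //.
  apply/forallP => j; suff -> : block_map [ffun jx => emb jx.1 (jx.2, g jx.1 jx.2)] j
    = part_map (emb j) (g j) by [].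
  by apply/ffunP => y; rewrite !ffunE.
apply: le_trans (Pr_union _ w0 predT _) _.
apply: le_trans (ler_sum _ (fun i _ => sm i)) _.
rewrite sumr_const card_ord -[leLHS]mulr_natl /L invf_div mulrA.
rewrite mulrCA mulfV ?mulr1 // gt_eqF // mulr_gt0 ?exprn_gt0 ?ltr0n //.
Qed.

End PartDensity.

(** * Maximum density *)

Lemma foldr_Rmax_ge (l : seq R) x : x \in l -> x <= foldr Rmax 0 l.
Proof.
elim: l => //= y l IH; rewrite inE RmaxE le_max => /predU1P[->|/IH ->]; first by rewrite lexx.
by rewrite orbT.
Qed.

Lemma foldr_Rmax_mem (l : seq R) : 0 < foldr Rmax 0 l -> foldr Rmax 0 l \in l.
Proof.
elim: l => /= [|y l IH]; first by rewrite ltxx.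
rewrite RmaxE inE maxEle; case: ifP => _; last by rewrite eqxx.
by move=> /IH ->; rewrite orbT.
Qed.

Section Density.
Variables (k : nat) (EH : {set {set 'I_k}}).
Implicit Type SF : {set 'I_k} * {set {set 'I_k}}.

Lemma densityE SF : density SF = #|SF.2|%:R / #|SF.1|%:R.
Proof. by rewrite /density RdivE !INRE. Qed.

Lemma induced_subgraph (S : {set 'I_k}) :
  S != set0 -> is_subgraph EH (S, [set e in EH | e \subset S]).
Proof.
move=> S0; apply/and3P; split=> //=; first by apply/subsetP => e; rewrite inE => /andP[].
by apply/forall_inP => e; rewrite inE => /andP[].
Qed.

Lemma mH_ge SF : is_subgraph EH SF -> #|SF.2|%:R <= mH EH * #|SF.1|%:R.
Proof.
move=> sub; have S0 : (0 < #|SF.1|)%N by rewrite card_gt0; case/and3P: sub.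
rewrite -ler_pdivrMr ?ltr0n // -densityE; apply: foldr_Rmax_ge.
by apply: map_f; rewrite mem_enum inE.
Qed.

Lemma edge_subgraph e : graph_wf EH -> e \in EH -> is_subgraph EH (e, [set e]).
Proof.
move=> wf eH; apply/and3P; split=> /=; first by rewrite -card_gt0 (wf e eH).
  by rewrite sub1set.
by apply/forall_inP => f; rewrite inE => /eqP ->.
Qed.

Lemma mH_gt0 : graph_wf EH -> EH != set0 -> 0 < mH EH.
Proof.
move=> wf /set0Pn[e eH]; have ce := wf e eH.
have := mH_ge (edge_subgraph wf eH); rewrite /= ce cards1 => le1.
by rewrite -(pmulr_lgt0 _ (ltr0Sn R 1)) (lt_le_trans ltr01).
Qed.

Lemma mH_attained : 0 < mH EH ->
  exists2 SF, is_subgraph EH SF & #|SF.2|%:R = mH EH * #|SF.1|%:R.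
Proof.
move=> /foldr_Rmax_mem /mapP[SF]; rewrite mem_enum inE => sub; rewrite -/(mH EH) => ->.
exists SF => //; rewrite densityE mulfVK // pnatr_eq0 -lt0n card_gt0.
by case/and3P: sub.
Qed.

End Density.

Lemma Un_cv_prob1 (u : nat -> R) : (forall n, u n <= 1) ->
  (forall eps : R, 0 < eps -> eventually (fun n => 1 - eps <= u n)) -> Un_cv u 1.
Proof.
move=> u1 H eps /RltP eps0; have [n0 Hn0] := H (eps / 2) (divr_gt0 eps0 (ltr0Sn _ 1)).
exists n0 => n /ssrnat.leP/Hn0 le; apply/RltP; rewrite RdistE ler0_norm ?subr_le0 ?u1 //.
have half : eps / 2 < eps by rewrite ltr_pdivrMr // ltr_pMr // ltr1n.
by rewrite opprB ltrBlDr -ltrBlDl (lt_le_trans _ le) // ltrD2l ltrN2.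
Qed.

(** * The threshold in G(n,p) *)

Section Gnp.
Variables (n : nat) (p : R).
Hypotheses (p_ge0 : 0 <= p) (p_le1 : p <= 1).

Definition gnp_weight (E : {set {set 'I_n}}) : R :=
  p ^+ #|E| * (1 - p) ^+ (#|Kedges n| - #|E|).

Definition gnp_support : seq {set {set 'I_n}} := enum (powerset (Kedges n)).

Lemma gnp_probE (P : {set {set 'I_n}} -> bool) :
  gnp_prob p P = Pr gnp_support gnp_weight P.
Proof.
rewrite /gnp_prob /Pr foldrE big_map [RHS]big_mkcond; apply: eq_bigr => E _.
by case: ifP => // _; rewrite !RpowE.
Qed.

Lemma gnp_weight_ge0 E : 0 <= gnp_weight E.
Proof. by rewrite mulr_ge0 ?exprn_ge0 // subr_ge0. Qed.

Lemma gnp_superset (F : {set {set 'I_n}}) : F \subset Kedges n ->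
  Pr gnp_support gnp_weight (fun E => F \subset E) = p ^+ #|F|.
Proof. exact: binomial_superset_sum. Qed.

Lemma gnp_sum1 : \sum_(E <- gnp_support) gnp_weight E = 1.
Proof.
have := gnp_superset (sub0set _); rewrite cards0 expr0 => <-.
by apply: eq_bigl => E; rewrite sub0set.
Qed.

End Gnp.

Section Threshold.
Variables (a b k : nat) (EH : {set {set 'I_k}}) (av : bool) (p : nat -> R).
Hypotheses (a_gt0 : (0 < a)%N) (b_gt0 : (0 < b)%N).
Hypotheses (EH_wf : graph_wf EH) (EH_n0 : EH != set0).
Hypothesis p01 : forall n, 0 <= p n <= 1.

Let D_gt0 := mH_gt0 EH_wf EH_n0.

Lemma wf_edge_gt1 : (1 < k)%N.
Proof.
case/set0Pn: EH_n0 => e eH; have := EH_wf eH.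
by have := max_card e; rewrite card_ord => + ce; rewrite ce.
Qed.

Lemma ratio_nroot n : Rdiv (p n) (Rpower (INR n) (Ropp (Rinv (mH EH)))) = p n * nroot (mH EH) n.
Proof. by rewrite Rpower_Ropp RdivE RinvE invrK. Qed.

Lemma gnp_prob_le1 n (P : {set {set 'I_n}} -> bool) : gnp_prob (p n) P <= 1.
Proof.
have /andP[p0 p1] := p01 n.
rewrite gnp_probE -(gnp_sum1 n (p n)); apply: Pr_mono => //; exact: gnp_weight_ge0.
Qed.

Lemma enforcer_above_threshold :
  (forall C : R, eventually (fun n => C <= p n * nroot (mH EH) n)) ->
  Un_cv (fun n => gnp_prob (p n) (fun E : {set {set 'I_n}} => enforcer_wins EH E a b av)) 1.
Proof.
move=> big; apply: Un_cv_prob1 => [n|eps eps0]; first exact: gnp_prob_le1.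
have k0 : (0 < k)%N := ltnW wf_edge_gt1.
have N0 : (0 < b.+1 ^ k.+1)%N by rewrite expn_gt0.
have EH_D (S : {set 'I_k}) : S != set0 -> (edges_in EH S)%:R <= mH EH * #|S|%:R.
  by move=> S0; apply: (mH_ge (induced_subgraph EH S0)).
have [C C0 HC] := whp_has_blocks D_gt0 k0 N0 EH_D EH_wf eps0.
apply: ev_mono (ev_and HC (big C)) => n [Hn le_p].
have /andP[p0 p1] := p01 n.
have x0 := nroot_gt0 (mH EH) n.
have le_p' : C / nroot (mH EH) n <= p n by rewrite ler_pdivrMr.
have p_gt0 : 0 < p n by apply: lt_le_trans le_p'; rewrite divr_gt0.
have := Hn _ _ _ id (fun j => p n ^+ j) (p n) (@gnp_weight_ge0 n _ p0 p1) (gnp_sum1 n _)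
  (@gnp_superset n (p n)) (exprn_gt0 _ p_gt0) _ le_p'.
have le_q c : (c <= #|EH|)%N -> p n ^+ (2 * #|EH| - c) * p n ^+ c <= (p n ^+ #|EH|) ^+ 2.
  by move=> le_c; rewrite -exprD subnK ?(leq_trans le_c) ?leq_pmull // mulnC exprM.
move=> /(_ le_q); rewrite Pr_compl ?gnp_sum1 // lerBlDr -lerBlDl => le1.
rewrite gnp_probE; apply: le_trans le1 _; apply: Pr_mono => [|E _].
  exact: gnp_weight_ge0.
case/existsP => f /andP[/injectiveP fI /forallP fE].
exact: (enforcer_wins_blocks a_gt0 b_gt0 av k0 fI fE).
Qed.

(** For a densest subgraph the first moment [n^|S| p^|F|] is exactly [(p n^(1/m(H)))^|F|]. *)
Lemma avoider_below_threshold :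
  (forall d : R, 0 < d -> eventually (fun n => p n * nroot (mH EH) n <= d)) ->
  Un_cv (fun n => gnp_prob (p n) (fun E : {set {set 'I_n}} => ~~ enforcer_wins EH E a b av)) 1.
Proof.
move=> small; apply: Un_cv_prob1 => [n|eps eps0]; first exact: gnp_prob_le1.
have [SF sub eSF] := mH_attained D_gt0.
have f0 : (0 < #|SF.2|)%N.
  rewrite -(ltr0n R) eSF mulr_gt0 // ltr0n card_gt0; by case/and3P: sub.
(* The bound by 1 allows the exponent [#|SF.2| >= 1] to be lowered to 1. *)
have d0 : 0 < Num.min 1 eps by rewrite lt_min ltr01.
apply: ev_mono (ev_and (ev_ge 1) (small _ d0)) => n [n0 le_p].
have /andP[p0 p1] := p01 n.
have x0 := nroot_gt0 (mH EH) n.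
rewrite gnp_probE Pr_compl ?gnp_sum1 // lerD2l lerN2.
apply: le_trans (_ : Pr _ _ (fun E => contains_copy EH E setT) <= _).
  apply: Pr_mono => [|E _]; first exact: gnp_weight_ge0.
  exact: enforcer_wins_copy.
apply: le_trans (first_moment_subgraph (p := p n) _ EH_wf p0 _ sub) _.
- exact: gnp_weight_ge0.
- by move=> F sF; rewrite gnp_superset.
rewrite -(nroot_exp_eq D_gt0 n0 eSF) -exprMn mulrC.
move: le_p; rewrite le_min => /andP[le1 le_eps]; apply: le_trans le_eps.
rewrite -[leRHS]expr1 ler_wiXn2l // mulr_ge0 // ltW //.
Qed.

End Threshold.

(** * The random graph process *)

Section ProcessLaw.
Variable n : nat.

Definition ordering_weight (s : seq {set 'I_n}) : R := (size (orderings n))%:R^-1.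

Lemma size_orderings_gt0 : (0 < size (orderings n))%N.
Proof.
have := mem_permutations (enum (Kedges n)) (enum (Kedges n)); rewrite perm_refl /orderings.
by case: permutations.
Qed.

Lemma ordering_weight_ge0 s : 0 <= ordering_weight s.
Proof. by rewrite invr_ge0. Qed.

Lemma proc_probE (Q : seq {set 'I_n} -> bool) : proc_prob Q = Pr (orderings n) ordering_weight Q.
Proof.
rewrite /proc_prob RdivE !INRE /Pr /ordering_weight big_const_seq iter_addr_0.
by rewrite -[RHS]mulr_natl.
Qed.

Lemma ordering_sum1 : \sum_(s <- orderings n) ordering_weight s = 1.
Proof.
rewrite big_const_seq iter_addr_0 count_predT -[LHS]mulr_natl mulfV //.
by rewrite pnatr_eq0 -lt0n size_orderings_gt0.
Qed.

Lemma proc_prob_le1 (Q : seq {set 'I_n} -> bool) : proc_prob Q <= 1.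
Proof.
rewrite proc_probE -ordering_sum1; apply: Pr_mono => //; exact: ordering_weight_ge0.
Qed.

Lemma proc_superset M (F : {set {set 'I_n}}) : (M <= #|Kedges n|)%N -> F \subset Kedges n ->
  Pr (orderings n) ordering_weight (fun s => F \subset proc_graph s M) =
  prefix_prod (draw_ratio R M #|Kedges n|) #|F|.
Proof.
rewrite cardE => le_M sF; apply: (ordering_superset_prob (enum_uniq _)) => //.
by apply: subset_trans sF _; apply/subsetP => e eK; rewrite inE mem_enum.
Qed.

Lemma proc_graph_sub (s : seq {set 'I_n}) i j :
  (i <= j)%N -> proc_graph s i \subset proc_graph s j.
Proof.
move=> le_ij; apply/subsetP => e; rewrite !inE -(take_takel s le_ij).
exact: mem_take.
Qed.

End ProcessLaw.

(** Both searches succeed by index [M], before the predicates can differ. *)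
Lemma find_iota_agree (P Q : pred nat) M K : (M < K)%N ->
  (forall i, (i <= M)%N -> P i = Q i) -> Q M -> find P (iota 0 K) = find Q (iota 0 K).
Proof.
move=> ltK PQ QM; rewrite -(subnKC ltK) iotaD !find_cat.
have eqPQ : {in iota 0 M.+1, P =1 Q} by move=> i; rewrite mem_iota add0n ltnS => /andP[_ /PQ].
rewrite (eq_in_has eqPQ); have -> : has Q (iota 0 M.+1).
  by apply/hasP; exists M => //; rewrite mem_iota /= add0n.
exact: eq_in_find.
Qed.

Section HittingTime.
Variables (a b k : nat) (av : bool).
Variables (N n0 : nat).
Hypothesis N_spec : forall (EH : {set {set 'I_k}}) n (E : {set {set 'I_n}}),
    (n0 <= n)%N -> copies_disjoint EH E ->
    enforcer_wins EH E a b av = has_N_copies EH N E.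
Hypothesis k_gt1 : (1 < k)%N.
Variable EH : {set {set 'I_k}}.
Hypotheses (EH_wf : graph_wf EH) (EH_sb : strictly_balanced EH).

Let k_gt0 : (0 < k)%N := ltnW k_gt1.
Let D : R := (#|EH|%:R / k%:R)%R.

Lemma sb_density SF : is_subgraph EH SF -> SF != (setT, EH) -> #|SF.2|%:R < D * #|SF.1|%:R.
Proof.
move=> sub neq; have /RltP := EH_sb sub neq; rewrite !densityE /= cardsT card_ord.
by rewrite ltr_pdivrMr // ltr0n card_gt0; case/and3P: sub.
Qed.

(** A single vertex is a proper subgraph of density 0 because [k > 1], and strict balance puts the
    density of [H] above it. *)
Lemma sb_edge : EH != set0.
Proof.
apply/eqP => E0; pose x : 'I_k := Ordinal k_gt0.
have sub : is_subgraph EH ([set x], set0).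
  apply/and3P; split=> /=; rewrite ?sub0set //; first by apply/set0Pn; exists x; rewrite inE.
  by apply/forall_inP => e; rewrite inE.
have neq : ([set x], set0) != (setT, EH).
  rewrite xpair_eqE negb_and; apply/orP; left; apply/eqP => /(congr1 (fun S : {set _} => #|S|)).
  by rewrite cards1 cardsT card_ord; lia.
by have := sb_density sub neq; rewrite /= cards0 /D E0 cards0 mulr0n !mul0r ltxx.
Qed.

Lemma D_gt0 : 0 < D.
Proof. by rewrite divr_gt0 ?ltr0n // card_gt0 sb_edge. Qed.

Lemma D_total : #|EH|%:R = D * k%:R :> R.
Proof. by rewrite mulfVK // pnatr_eq0 -lt0n. Qed.

Lemma sb_density_le SF : is_subgraph EH SF -> #|SF.2|%:R <= D * #|SF.1|%:R.
Proof.
move=> sub; have [->|neq] := eqVneq SF (setT, EH); last exact/ltW/sb_density.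
by rewrite /= cardsT card_ord D_total.
Qed.

Lemma D_ge_half : 1 <= D * 2%:R.
Proof.
case/set0Pn: sb_edge => e eH; have ce := EH_wf eH.
by have := sb_density_le (edge_subgraph EH_wf eH); rewrite /= ce cards1.
Qed.

Lemma card_Kedges_ge n : (1 < n)%N -> (n ^ 2 <= 4 * #|Kedges n|)%N.
Proof.
move=> n1; rewrite /Kedges card_draws card_ord bin2 expnS expn1.
have := odd_double_half (n * n.-1); rewrite -muln2.
have -> : odd (n * n.-1) = false.
  by case: n n1 => // m _ /=; rewrite oddM /= andNb.
by rewrite add0n; nia.
Qed.

(* [n^2 >= n^(1/D)] because [D >= 1/2], so rounding costs a constant factor only. *)
Lemma choose_time (C : R) : 0 < C -> exists2 C' : R, 0 < C' & eventually (fun n =>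
  exists M, [/\ (M <= #|Kedges n|)%N, (#|EH| < M)%N,
    C / nroot D n <= (M - #|EH|)%:R / #|Kedges n|%:R
    & M%:R / #|Kedges n|%:R <= C' / nroot D n]).
Proof.
(* The second summand pays for the [#|EH|.+1] extra edges of [M]: there are at least [n^2 / 4] edges
   in total and [nroot D n <= n^2]. *)
move=> C0; pose C' : R := (C + 4%:R * #|EH|.+1%:R)%R.
have C'0 : 0 < C' by rewrite addr_gt0 // mulr_gt0 ?ltr0n.
exists C' => //; apply: ev_mono (ev_and (ev_ge 2) (nroot_large D_gt0 C')) => n [n2 le_x].
have x0 := nroot_gt0 D n; set x := nroot D n in x0 le_x *.
have x_le : x <= n%:R ^+ 2.
  by rewrite -[leLHS]expr1; apply: (nroot_exp_le D_gt0 (ltnW n2) (j := 1)); apply: D_ge_half.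
have leT := card_Kedges_ge n2; set T := #|Kedges n| in leT *.
have T0 : (0 < T)%N by nia.
have T0' : 0 < T%:R :> R by rewrite ltr0n.
pose y := C * T%:R / x.
have y0 : 0 <= y by rewrite divr_ge0 ?mulr_ge0 // ltW.
have /andP[t1 t2] := Num.Theory.truncn_itv y0; set t := Num.truncn y in t1 t2.
(* [#|EH|] edges are added so that even the last of the first [#|EH|] draw ratios stays above the
   required bound. *)
pose M := (t.+1 + #|EH|)%N.
have leM : M%:R / T%:R <= C' / x.
  rewrite ler_pdivrMr // mulrAC ler_pdivlMr //.
  have -> : M%:R = t%:R + #|EH|.+1%:R :> R by rewrite /M addSnnS natrD.
  rewrite mulrDl /C' mulrDl; apply: lerD; first by rewrite -ler_pdivlMr.
  rewrite [4%:R * _]mulrC -mulrA; apply: ler_wpM2l => //.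
  by apply: le_trans x_le _; rewrite -natrX -natrM ler_nat.
exists M; split=> //; last 2 first.
- by rewrite /M; lia.
- rewrite ler_pdivlMr // (_ : M - #|EH| = t.+1)%N; last by rewrite /M; lia.
  by rewrite mulrAC ltW.
have : M%:R / T%:R <= 1 :> R by apply: le_trans leM _; rewrite ler_pdivrMr // mul1r.
by rewrite ler_pdivrMr // mul1r ler_nat.
Qed.

(** Put [x = n^(1/D)], so that [x^e(H) = n^v(H)]. The term becomes a constant times
    [x^e(F) / n^v(F)], which vanishes in the limit because a proper subgraph has density below
    [D]. *)
Lemma clash_term_small (C' d : R) SF : 0 < C' -> 0 < d ->
  is_subgraph EH SF -> SF != (setT, EH) -> eventually (fun n =>
    (k ^ k)%:R * n%:R ^+ (2 * k - #|SF.1|) * (C' / nroot D n) ^+ (2 * #|EH| - #|SF.2|) <= d).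
Proof.
move=> C'0 d0 sub neq; pose j := (2 * #|EH| - #|SF.2|)%N.
pose K : R := ((k ^ k)%:R * C' ^+ j)%R.
have K0 : 0 < K by rewrite mulr_gt0 ?exprn_gt0 // ltr0n expn_gt0 k_gt0.
have dK : 0 < d / K by rewrite divr_gt0.
apply: ev_mono (ev_and (ev_ge 1) (nroot_exp_small D_gt0 dK (sb_density sub neq))) => n [n1].
have x0 := nroot_gt0 D n; set x := nroot D n in x0 *.
have n0' : 0 < n%:R :> R by rewrite ltr0n.
move=> le; rewrite -/j.
have le_s : (#|SF.1| <= 2 * k)%N by have := max_card SF.1; rewrite card_ord; lia.
have le_e : (#|SF.2| <= 2 * #|EH|)%N.
  by case/and3P: sub => _ /subset_leq_card le_e _; lia.
have xn : x ^+ (2 * #|EH|) = n%:R ^+ (2 * k).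
  by rewrite mulnC exprM (nroot_exp_eq D_gt0 n1 D_total) -exprM mulnC.
have xj : 0 < x ^+ j by rewrite exprn_gt0.
have ns : 0 < n%:R ^+ #|SF.1| :> R by rewrite exprn_gt0.
have nx : n%:R ^+ (2 * k - #|SF.1|) * n%:R ^+ #|SF.1| = x ^+ j * x ^+ #|SF.2|.
  by rewrite -!exprD !subnK.
have -> : n%:R ^+ (2 * k - #|SF.1|) = x ^+ j * x ^+ #|SF.2| / n%:R ^+ #|SF.1|.
  by rewrite -nx mulfK // gt_eqF.
have -> : (k ^ k)%:R * (x ^+ j * x ^+ #|SF.2| / n%:R ^+ #|SF.1|) * (C' / x) ^+ j =
    (x ^+ #|SF.2| / n%:R ^+ #|SF.1|) * K.
  have alg (A B Y Z c : R) : B != 0 -> A * (B * Y / Z) * (c / B) = Y / Z * (A * c).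
    by move=> B0; rewrite -[B * Y / Z]mulrA; move: (Y / Z) => V; field.
  by rewrite expr_div_n /K alg // gt_eqF.
by rewrite -ler_pdivlMr // ler_pdivrMr.
Qed.

Lemma tau_eq n (s : seq {set 'I_n}) M : (n0 <= n)%N -> s \in orderings n ->
  (M <= #|Kedges n|)%N -> has_blocks N.+1 EH (proc_graph s M) ->
  ~~ has_clash EH (proc_graph s M) ->
  tau s (fun E : {set {set 'I_n}} => enforcer_wins EH E a b av)
  = tau s (fun E : {set {set 'I_n}} => has_N_copies EH N E).
Proof.
move=> le_n; rewrite mem_permutations => /perm_size; rewrite -cardE => size_s le_M.
move=> /existsP[f /andP[/injectiveP fI /forallP fE]] /no_clash_disjoint disj.
apply: (find_iota_agree (M := M)); first by rewrite size_s.
  move=> i le_i; apply: N_spec => //.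
  exact: copies_disjoint_mono (proc_graph_sub s le_i) disj.
exact: ltnW (num_copies_blocks k_gt0 fI fE).
Qed.

(** The time [M] is a constant multiple of the threshold, with the constant fixed by [eps] so that
    the disjoint copies exist. At any fixed multiple clashes remain unlikely, so the two
    requirements are compatible and each fails with probability at most [eps / 2]. *)
Lemma hitting_time_whp :
  Un_cv (fun n => proc_prob (fun s : seq {set 'I_n} =>
     tau s (fun E : {set {set 'I_n}} => enforcer_wins EH E a b av)
     == tau s (fun E : {set {set 'I_n}} => has_N_copies EH N E))) 1.
Proof.
apply: Un_cv_prob1 => [n|eps eps0]; first exact: proc_prob_le1.
have eps2 : 0 < eps / 2%:R by rewrite divr_gt0 // ltr0n.
have EH_D (S : {set 'I_k}) : S != set0 -> (edges_in EH S)%:R <= D * #|S|%:R.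
  by move=> S0; apply: (sb_density_le (induced_subgraph EH S0)).
(* [N.+1] blocks are requested to have a positive number of them. *)
have [C C0 HC] := whp_has_blocks D_gt0 k_gt0 (ltn0Sn N) EH_D EH_wf eps2.
have [C' C'0 HM] := choose_time C0.
pose P SF := is_subgraph EH SF && (SF != (setT, EH)).
pose F (SF : {set 'I_k} * {set {set 'I_k}}) n : R := ((k ^ k)%:R * n%:R ^+ (2 * k - #|SF.1|) *
   (C' / nroot D n) ^+ (2 * #|EH| - #|SF.2|))%R.
have small : eventually (fun n => \sum_(SF | P SF) F SF n <= eps / 2%:R).
  apply: ev_sum_small => // SF /andP[sub neq] d d0; exact: clash_term_small.
apply: ev_mono (ev_and (ev_and (ev_ge n0) HC) (ev_and HM small)) =>
  n [[le_n Hn] [[M [le_M lt_M rho_ge p_le]] sum_le]].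
have w0 := @ordering_weight_ge0 n; have w1 := ordering_sum1 n.
have supM Fs := @proc_superset n M Fs le_M.
set T := #|Kedges n| in le_M rho_ge p_le supM.
pose f := draw_ratio R M T; pose rho : R := ((M - #|EH|)%:R / T%:R)%R.
have f_ge0 i : 0 <= f i := draw_ratio_ge0 R M T i.
have f_noninc i j : (i <= j)%N -> f j <= f i by apply: draw_ratio_noninc.
have T0 : 0 < T%:R :> R by rewrite ltr0n; lia.
have rho0 : 0 < rho by rewrite divr_gt0 // ltr0n subn_gt0.
have rho_le i : (i < #|EH|)%N -> rho <= f i.
  move=> lt_i; rewrite /rho /f /draw_ratio ler_pdivrMr // mulrAC ler_pdivlMr ?ltr0n; last lia.
  by rewrite -!natrM ler_nat; apply: leq_mul; lia.
have q0 : 0 < prefix_prod f #|EH|.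
  by apply: prodr_gt0 => i _; apply: lt_le_trans rho0 _; apply: rho_le.
have blocks : Pr (orderings n) (@ordering_weight n)
    (fun s => ~~ has_blocks N.+1 EH (proc_graph s M)) <= eps / 2%:R.
  apply: (Hn _ _ _ (fun s => proc_graph s M) (prefix_prod f) rho) => // c le_c.
  by apply: prefix_prod_log => //; apply: ltW.
have p0 : 0 <= C' / nroot D n by rewrite divr_ge0 // ltW // nroot_gt0.
have clash : Pr (orderings n) (@ordering_weight n)
    (fun s => has_clash EH (proc_graph s M)) <= eps / 2%:R.
  apply: le_trans sum_le; apply: first_moment_clash => // Fs sFs.
  rewrite supM //; apply: le_trans (prefix_prod_le f_ge0 f_noninc _) _.
  apply: lerXn2r; rewrite ?nnegrE //.
  by rewrite /f /draw_ratio !subn0.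
rewrite proc_probE.
pose bad i (s : seq {set 'I_n}) := if i then ~~ has_blocks N.+1 EH (proc_graph s M)
  else has_clash EH (proc_graph s M).
have bad_le : Pr (orderings n) (@ordering_weight n) (fun s => [exists i in predT, bad i s]) <= eps.
  apply: le_trans (Pr_union _ w0 predT bad) _; rewrite big_bool /=.
  by apply: le_trans (lerD blocks clash) _; rewrite -splitr.
apply: le_trans (_ : 1 - Pr (orderings n) (@ordering_weight n)
    (fun s => [exists i in predT, bad i s]) <= _).
  by rewrite lerD2l lerN2.
rewrite -Pr_compl //; apply: Pr_mono => // s s_ord /existsPn nbad.
have := nbad true; have := nbad false; rewrite /= negbK => nclash blk.
by apply/eqP; apply: tau_eq le_n s_ord le_M _ _.
Qed.

End HittingTime.

Local Open Scope R_scope.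

Theorem theorem6 :
  forall a b : nat, (0 < a)%N -> (0 < b)%N ->
  (forall (k : nat) (EH : {set {set 'I_k}}), graph_wf EH -> EH != set0 ->
   forall (avoider_first : bool) (p : nat -> R),
     (forall n, 0 <= p n <= 1) ->
     (cv_infty (fun n => p n / Rpower (INR n) (- / mH EH)) ->
        Un_cv (fun n => gnp_prob (p n)
                 (fun E : {set {set 'I_n}} => enforcer_wins EH E a b avoider_first)) 1)
     /\
     (Un_cv (fun n => p n / Rpower (INR n) (- / mH EH)) 0 ->
        Un_cv (fun n => gnp_prob (p n)
                 (fun E : {set {set 'I_n}} => ~~ enforcer_wins EH E a b avoider_first)) 1))
  /\
  (forall (avoider_first : bool) (k : nat), exists N : nat,
     forall EH : {set {set 'I_k}}, graph_wf EH -> strictly_balanced EH ->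
       Un_cv (fun n => proc_prob (fun s : seq {set 'I_n} =>
                 tau s (fun E : {set {set 'I_n}} => enforcer_wins EH E a b avoider_first)
                 == tau s (fun E : {set {set 'I_n}} => has_N_copies EH N E))) 1).
Proof.
move=> a b a0 b0; split.
  move=> k EH wf EH0 av p p01.
  have p01' n : ((0 : R) <= p n <= 1)%R by have [/RleP p0 /RleP p1] := p01 n; rewrite p0.
  split=> H.
    apply: enforcer_above_threshold => // C; have [n0 Hn0] := H C.
    exists n0 => n /ssrnat.leP/Hn0; rewrite ratio_nroot => /RltP; exact: ltW.
  apply: avoider_below_threshold => // d /RltP /H [n0 Hn0].
  exists n0 => n /ssrnat.leP/Hn0; rewrite ratio_nroot => /RltP.
  by rewrite RdistE subr0 => /ltW; apply: le_trans; apply: ler_norm.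
move=> av k; have [k1|k1] := leqP k 1; last first.
  have [N [n0 HN]] := enforcer_wins_iff_copies a0 b0 av (ltnW k1).
  exists N => EH wf sb; exact: (hitting_time_whp HN k1 wf sb).
(* On at most one vertex there are no edges; from [n = (b+1)^2] on, Enforcer wins already on the
   empty graph, so with [N = 0] both hitting times are 0. *)
exists 0%N => EH wf _; apply: Un_cv_prob1 => [n|eps eps0]; first exact: proc_prob_le1.
have EH0 : EH = set0.
  apply/setP => e; rewrite inE; apply/negP => /wf ce.
  by have := max_card e; rewrite card_ord ce; lia.
exists (b.+1 ^ 2)%N => n le_n; rewrite proc_probE -[X in (X - _ <= _)%R](ordering_sum1 n).
rewrite (eq_bigl (fun s => tau s (fun E : {set {set 'I_n}} => enforcer_wins EH E a b av)
                 == tau s (fun E : {set {set 'I_n}} => has_N_copies EH 0 E))).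
  by rewrite lerBlDr lerDl ltW.
by move=> s; rewrite /tau /= EH0 edgeless_enforcer_wins.
Qed.
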